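(* Let $d\ge2$ and let $P\in\mathcal{P}_d$ be a generalized permutahedron. Then $\mathcal{E}(P)\ge0$. (Consequently, the linear coefficient of the Ehrhart polynomial of every generalized permutahedron with integer vertices is nonnegative.)
   Context: $\Delta_I=\mathrm{conv}\{e_i:i\in I\}$ for $\emptyset\ne I\subseteq[d]$, $\Delta_\emptyset=\{0\}$. $\mathcal{P}_d$ is the class of generalized permutahedra in $\mathbb{R}^d$: polytopes which are Minkowski summands of $\lambda\Pi_d$ for some $\lambda>0$, where $\Pi_d=\mathrm{conv}\{(\sigma(1),\dots,\sigma(d)):\sigma\in S_d\}$. Every $P\in\mathcal{P}_d$ has a unique signed Minkowski representation $P=\sum_{\emptyset\ne I\subseteq[d]}y_I\Delta_I$ with real $y_I$ (meaning $P+\sum_{y_I<0}(-y_I)\Delta_I=\sum_{y_I\ge0}y_I\Delta_I$). Let $h_0=0$ and $h_i=1+\frac12+\dots+\frac1i$ for $i\ge1$, and $\mathcal{E}(\sum_I y_I\Delta_I)=\sum_{\emptyset\ne I}y_Ih_{|I|-1}$. For a lattice polytope, the Ehrhart polynomial $E_P(n)=|nP\cap\mathbb{Z}^d|$ ($n\ge1$), and $\mathcal{E}(P)$ equals its linear coefficient when $P\in\mathcal{P}_d$ has integer vertices. *)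

(* Defs.v *)
(* MathComp + MathComp-Analysis. Points of R^d are row vectors 'rV[R]_d over an
   arbitrary R : realType; the ground set [d] is 'I_d = {0, ..., d-1}. *)
From mathcomp Require Export all_boot all_order all_algebra all_fingroup.
From mathcomp Require Export boolp classical_sets functions cardinality reals.

Set Implicit Arguments.
Unset Strict Implicit.
Unset Printing Implicit Defensive.

Import Order.TTheory GRing.Theory Num.Theory.
Local Open Scope classical_set_scope.
Local Open Scope card_scope.
Local Open Scope ring_scope.

Section GeneralizedPermutahedra.
Context {R : realType} {d : nat}.
Implicit Types (A B P : set 'rV[R]_d) (y : {set 'I_d} -> R).

Definition conv A : set 'rV[R]_d :=
  [set x | exists (n : nat) (a : 'I_n -> R) (v : 'I_n -> 'rV[R]_d),
    [/\ forall i, 0 <= a i, \sum_i a i = 1, forall i, A (v i)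
      & x = \sum_i a i *: v i]].

(* The empty set counts as a polytope here. *)
Definition polytope P : Prop :=
  exists s : seq 'rV[R]_d, P = conv [set x | x \in s].

Definition msum A B : set 'rV[R]_d := [set a + b | a in A & b in B].

Definition dilate (t : R) A : set 'rV[R]_d := [set t *: a | a in A].

Definition permutahedron : set 'rV[R]_d :=
  conv [set x | exists s : 'S_d, x = \row_i (s i).+1%:R].

Definition minkowski_summand P A : Prop :=
  polytope P /\ exists2 Q, polytope Q & msum P Q = A.

Definition generalized_permutahedron P : Prop :=
  exists2 t : R, 0 < t & minkowski_summand P (dilate t permutahedron).

Definition simplex (I : {set 'I_d}) : set 'rV[R]_d :=
  if I == finset.set0 then [set 0]
  else conv [set x | exists2 i, i \in I & x = delta_mx 0 i].

Definition weighted_msum (J : pred {set 'I_d}) y : set 'rV[R]_d :=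
  \big[msum/[set 0]]_(I : {set 'I_d} | (I != finset.set0) && J I)
    dilate (y I) (simplex I).

(* P = \sum_I y_I Delta_I over nonempty I, for coefficients of arbitrary sign,
   with the negative terms moved to the left-hand side. The value of y at the
   empty set is irrelevant, here and in [mink_functional]. *)
Definition signed_minkowski_rep P y : Prop :=
  msum P (weighted_msum (fun I => y I < 0) (fun I => - y I)) =
  weighted_msum (fun I => 0 <= y I) y.

Definition harmonic_number (n : nat) : R := \sum_(i < n) i.+1%:R^-1.

(* The functional E, as a function of the coefficients of the (unique) signed
   Minkowski representation of a generalized permutahedron. *)
Definition mink_functional y : R :=
  \sum_(I : {set 'I_d} | I != finset.set0) y I * harmonic_number #|I|.-1.

Definition integral_point (x : 'rV[R]_d) : Prop :=
  forall i, x 0 i \is a Num.int.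

(* Vertices are the 0-dimensional faces: unique maximizers of some linear
   functional. *)
Definition vertex P (v : 'rV[R]_d) : Prop :=
  P v /\ exists c : 'rV[R]_d, forall x, P x -> x <> v ->
    \sum_i c 0 i * x 0 i < \sum_i c 0 i * v 0 i.

Definition integer_vertices P : Prop := forall v, vertex P v -> integral_point v.

Definition ehrhart_polynomial P (p : {poly R}) : Prop :=
  forall n : nat, (0 < n)%N -> exists2 k : nat,
    (dilate n%:R P `&` [set x | integral_point x]) #= `I_k & p.[n%:R] = k%:R.

End GeneralizedPermutahedra.

(* Main.v *)
Require Import Defs.
From mathcomp Require Import finmap fsbigop zify ring lra.
Set Implicit Arguments.
Unset Strict Implicit.
Unset Printing Implicit Defensive.
Import Order.TTheory GRing.Theory Num.Theory.
Local Open Scope classical_set_scope.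
Local Open Scope ring_scope.

(* A generalized permutahedron is the base polytope of the submodular function
   z(I) = max_P x(I): in a decomposition P + Q = t Pi_d the P-part of the vertex
   of t Pi_d belonging to a linear order maximises x(I) over P for all initial
   segments I at once. Since z(I) is the sum of the y_K over the K that meet I,
   submodularity makes the sum of the y_K over {i, j} <= K <= U nonnegative.
   Summing over pairs, the sum of |K| (|K| - 1) y_K over K <= U is nonnegative,
   and E(y) is a nonnegative combination of these because
   k |-> h_(k-1) / (k (k - 1)) is completely monotone.

   For the Ehrhart coefficient, the indicator of the base polytope at a lattice
   point x is the sum of (-1)^|C| over the chains C of sets I with x(I) > z(I)
   (that poset is empty or contractible). Summed over x this makes sense for
   every z, and its difference in the direction of a coordinate I is the same sum
   over points with x(I) fixed; so it is a polynomial in z. Its linear part is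
   additive in z, hence determined by the simplices. *)

(** * Complete monotonicity and the sign of the functional *)

Section CompleteMonotonicity.
Context {R : realFieldType}.
Implicit Types f g : nat -> R.

Definition bdiff f : nat -> R := fun n => f n - f n.+1.

Definition completely_monotone f := forall s n, 0 <= iter s bdiff f n.

Lemma iter_bdiffD s f g n :
  iter s bdiff (fun m => f m + g m) n = iter s bdiff f n + iter s bdiff g n.
Proof. by elim: s n => //= s IH n; rewrite /bdiff !IH; ring. Qed.

Lemma eq_iter_bdiff s f g n : f =1 g -> iter s bdiff f n = iter s bdiff g n.
Proof. by move=> fg; elim: s n => //= s IH n; rewrite /bdiff !IH. Qed.

Lemma iter_bdiffS s f n : iter s bdiff (fun m => f m.+1) n = iter s bdiff f n.+1.
Proof. by elim: s n => //= s IH n; rewrite /bdiff !IH. Qed.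

Lemma cm_bdiff f : completely_monotone f -> completely_monotone (bdiff f).
Proof. by move=> fcm s n; rewrite -iterSr. Qed.

Lemma cm_shift f : completely_monotone f -> completely_monotone (fun n => f n.+1).
Proof. by move=> fcm s n; rewrite iter_bdiffS. Qed.

(** Leibniz rule: [bdiff] of the product is [bdiff f m * g m + f m.+1 * bdiff g m], a sum of two
    products to which the induction on the order applies. *)
Lemma cm_mul f g : completely_monotone f -> completely_monotone g ->
  completely_monotone (fun n => f n * g n).
Proof.
move=> + + s; elim: s f g => [|s IH] f g fcm gcm n.
  by rewrite mulr_ge0 ?(fcm 0%N) ?(gcm 0%N).
rewrite iterSr (_ : iter s _ _ n =
  iter s bdiff (fun m => bdiff f m * g m + f m.+1 * bdiff g m) n); last first.
  by apply: eq_iter_bdiff => m; rewrite /bdiff; ring.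
rewrite iter_bdiffD addr_ge0 // IH //; first exact: cm_bdiff.
  exact: cm_shift.
exact: cm_bdiff.
Qed.

Lemma iter_bdiff_eq (B : nat -> nat -> R) f :
  (forall n, B 0%N n = f n) ->
  (forall s n, B s.+1 n = B s n - B s n.+1) ->
  forall s n, iter s bdiff f n = B s n.
Proof. by move=> B0 BS; elim=> [|s IH] n /=; rewrite ?B0 // /bdiff !IH BS. Qed.

(** Binomial expansion of 1 = ([bdiff] + shift)^m, evaluated at [k - m]. *)
Lemma sum_bin_iter_bdiff f m k : (m <= k)%N ->
  \sum_(s < m.+1) ('C(m, s))%:R * iter s bdiff f (k - s)%N = f (k - m)%N.
Proof.
elim: m k => [|m IH] k mk; first by rewrite big_ord1 bin0 mul1r.
rewrite big_ord_recl bin0 mul1r /=.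
under eq_bigr => i _ do rewrite /bump /= add1n binS natrD mulrDl /=.
rewrite big_split /= big_ord_recr /= bin_small // mul0r addr0.
have -> : \sum_(i < m.+1) 'C(m, i)%:R * bdiff (iter i bdiff f) (k - i.+1)
  = f (k - m.+1)%N - f (k - m)%N.
  rewrite -[in RHS](IH k) 1?ltnW // subnS -subn1 subnAC subn1 -(IH k.-1); last by lia.
  rewrite -sumrB; apply: eq_bigr => i _; rewrite /bdiff -mulrBr.
  have -> : (k - i.+1).+1 = (k - i)%N by have := ltn_ord i; lia.
  by have -> : (k - i.+1 = k.-1 - i)%N by lia.
have := IH k (ltnW mk); rewrite big_ord_recl bin0 mul1r /= => <-.
by ring.
Qed.

End CompleteMonotonicity.

Ltac nonzero := repeat (apply/andP; split); first
  [ by rewrite pnatr_eq0 -lt0n fact_gt0 | by apply: lt0r_neq0; lra ].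

Section Harmonic.
Context {R : realType}.

Lemma harmonicS n :
  harmonic_number n.+1 = harmonic_number n + n.+1%:R^-1 :> R.
Proof. by rewrite /harmonic_number big_ord_recr. Qed.

Lemma harmonic_mono m n : (m <= n)%N -> harmonic_number m <= harmonic_number n :> R.
Proof.
move=> /subnK <-; elim: (n - m)%N => // k IH.
by rewrite addSn harmonicS (le_trans IH) // lerDl invr_ge0 ler0n.
Qed.

Lemma cm_inv : completely_monotone (fun n => n.+2%:R^-1 : R).
Proof.
move=> s n.
(* The closed form is the Beta integral of x^(n+1) (1-x)^s over [0,1]. *)
rewrite (iter_bdiff_eq (B := fun s n => s`!%:R * n.+1`!%:R / (n + s).+2`!%:R)).
- by rewrite divr_ge0 ?mulr_ge0 ?ler0n.
- move=> m; rewrite addn0 fact0 mul1r [in X in _ / X]factS natrM.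
  have m0 := ler0n R m; field; nonzero.
- move=> t m; rewrite addnS addSn !(factS t) !(factS m.+1) !(factS (m + t).+2) !natrM.
  have m0 := ler0n R m; have t0 := ler0n R t; field; nonzero.
Qed.

Lemma cm_harmonic : completely_monotone (fun n => harmonic_number n.+1 / n.+1%:R : R).
Proof.
move=> s n.
(* The closed form is the integral of - x^n (1-x)^s log(1-x) over [0,1]. *)
rewrite (iter_bdiff_eq (B := fun s n => s`!%:R * n`!%:R / (n + s).+1`!%:R *
   (harmonic_number (n + s).+1 - harmonic_number s))).
- rewrite mulr_ge0 ?divr_ge0 ?mulr_ge0 ?ler0n // subr_ge0 harmonic_mono //; lia.
- move=> m; rewrite addn0 fact0 mul1r [in X in _ / X]factS natrM.
  rewrite {2}/harmonic_number big_ord0 subr0.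
  have m0 := ler0n R m; field; nonzero.
- move=> t m; rewrite addnS addSn !(factS t) !(factS m) !(factS (m + t).+1) !natrM.
  rewrite !(harmonicS (m + t).+1) (harmonicS t).
  have m0 := ler0n R m; have t0 := ler0n R t; field; nonzero.
Qed.

(** This is h_(k-1) / (k (k-1)) at k = n + 2. *)
Definition harmonic_ratio n : R := harmonic_number n.+1 / n.+1%:R * n.+2%:R^-1.

Lemma cm_harmonic_ratio : completely_monotone harmonic_ratio.
Proof. exact: cm_mul cm_harmonic cm_inv. Qed.

End Harmonic.
Definition submodular {T : finType} {V : numDomainType} (z : {set T} -> V) :=
  forall I J, z (I :|: J)%SET + z (I :&: J)%SET <= z I + z J.

(** For nonempty [K], as a number, the maximum of x(I) over the simplex Delta_K. *)
Definition meets {T : finType} (K I : {set T}) : bool := (K :&: I)%SET != finset.set0.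

Section Core.
Context {R : realType} {d : nat}.
Implicit Types (I J K U : {set 'I_d}) (y : {set 'I_d} -> R).

(** Submodularity for the sets i + ~U and j + ~U. A set [K] inside [U] contributes to the defect
    exactly when it contains both i and j; any other [K] meets all four sets, and its terms
    cancel. *)
Lemma sum_pairs_ge0 y :
  submodular (fun I => \sum_(K | K != finset.set0) y K * (meets K I)%:R) ->
  forall U i j, i != j -> i \in U -> j \in U ->
  0 <= \sum_(K : {set 'I_d} | K \subset U) y K * ((i \in K) && (j \in K))%:R.
Proof.
move=> sub U i j ij iU jU.
have := sub (i |: ~: U)%SET (j |: ~: U)%SET.
rewrite -subr_ge0 -!big_split -sumrB /= big_mkcond /=.
set X := leRHS; set Y := (X in _ -> _ <= X); suff -> : Y = X by [].
rewrite /Y big_mkcond /=; apply: eq_bigr => K _; rewrite /meets.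
have E a : (K :&: (a |: ~: U)%SET != finset.set0)%SET = (a \in K) || ~~ (K \subset U).
  rewrite finset.setIUr finset.setU_eq0 negb_and; congr (_ || _).
    by rewrite finset.setI_eq0 disjoint_sym disjoints1 negbK.
  by rewrite finset.setI_eq0 finset.disjoints_subset finset.setCK.
have -> : ((i |: ~: U) :|: (j |: ~: U) = (i |: (j |: ~: U)))%SET.
  by apply/setP => a; rewrite !finset.inE; do !case: (_ \in _) => //; do !case: (_ == _).
have -> : ((i |: ~: U) :&: (j |: ~: U) = ~: U)%SET.
  apply/setP => a; rewrite !finset.inE; case: (a \in U) / boolP => aU; rewrite /= ?orbT ?orbF //.
  by apply/negP => /andP[/eqP -> /eqP ji]; rewrite ji eqxx in ij.
rewrite (E i) (E j).
have -> : (K :&: (i |: (j |: ~: U)) != finset.set0)%SET = [|| i \in K, j \in K | ~~ (K \subset U)].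
  by rewrite -E finset.setIUr finset.setU_eq0 negb_and finset.setI_eq0 disjoint_sym disjoints1 negbK.
have -> : (K :&: ~: U != finset.set0)%SET = ~~ (K \subset U).
  by rewrite finset.setI_eq0 finset.disjoints_subset finset.setCK.
have [->|K0] /= := eqVneq K finset.set0.
  by rewrite !finset.inE mulr0 if_same.
by case: (K \subset U); case: (i \in K); case: (j \in K) => /=; lra.
Qed.

(** Grouping the [U] by the size s of their complement, a subset of ~K, gives [sum_bin_iter_bdiff]
    with m = d - |K| and k = d - 2. *)
Lemma harmonic_sum_subsets K : (1 < #|K|)%N ->
  \sum_(U : {set 'I_d} | K \subset U) iter (d - #|U|) bdiff harmonic_ratio (#|U| - 2)%N
  = harmonic_ratio (#|K| - 2)%N :> R.
Proof.
move=> K1; have Kd : (#|K| <= d)%N by rewrite -[X in (_ <= X)%N]card_ord max_card.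
rewrite (reindex_inj (@finset.setC_inj _)) /=.
rewrite (eq_bigl (fun V => V \in powerset (~: K)%SET)); last first.
  by move=> V; rewrite finset.inE finset.subsetC.
have cK : #|(~: K)%SET| = (d - #|K|)%N by rewrite cardsCs finset.setCK card_ord.
rewrite (partition_big (fun V : {set 'I_d} => inord #|V| : 'I_(d - #|K|).+1) predT) //=.
have -> : (#|K| - 2 = (d - 2) - (d - #|K|))%N by lia.
rewrite -sum_bin_iter_bdiff; last by lia.
apply: eq_bigr => s _; rewrite -[X in 'C(X, _)]cK -cards_draws -sum1_card natr_sum mulr_suml.
rewrite [RHS]big_mkcond [LHS]big_mkcond /=; apply: eq_bigr => V _.
rewrite !finset.inE; case: (boolP (V \subset _)) => //= VK.
have Vd : (#|V| <= d - #|K|)%N by rewrite -cK subset_leq_card.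
have -> : (inord #|V| == s) = (#|V| == s).
  by rewrite -val_eqE /= inordK // ltnS.
case: eqP => // <-; rewrite mul1r.
have -> : #|(~: V)%SET| = (d - #|V|)%N by rewrite cardsCs finset.setCK card_ord.
by congr (iter _ _ _ _); lia.
Qed.

Theorem mink_functional_ge0 y :
  submodular (fun I => \sum_(K | K != finset.set0) y K * (meets K I)%:R) ->
  0 <= mink_functional y.
Proof.
move=> sub.
pose W U := \sum_(K : {set 'I_d} | K \subset U) y K * (#|K| * #|K|.-1)%:R.
have W0 U : 0 <= W U.
  (* |K| (|K| - 1) counts the ordered pairs of distinct elements of [K]. *)
  have -> : W U = \sum_(i in U) \sum_(j in U | j != i)
      \sum_(K : {set 'I_d} | K \subset U) y K * ((i \in K) && (j \in K))%:R.
    under [RHS]eq_bigr => i _ do rewrite exchange_big /=.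
    rewrite [RHS]exchange_big /=; apply: eq_bigr => K KU.
    under eq_bigr => i _ do rewrite -mulr_sumr.
    rewrite -mulr_sumr; congr (_ * _).
    rewrite (bigID (mem K)) /= [X in _ = _ + X]big1 ?addr0; last first.
      move=> i /andP[_ /negbTE iK]; rewrite big1 // => j _; by rewrite iK.
    rewrite (eq_bigl (fun i => i \in K)); last first.
      by move=> i /=; rewrite andbC; case: (boolP (i \in K)) => //= /(fintype.subsetP KU) ->.
    rewrite (eq_bigr (fun=> #|K|.-1%:R)) ?sumr_const ?natrM ?mulr_natl //.
    move=> i iK; rewrite (cardsD1 i K) iK /= -sum1_card natr_sum.
    rewrite big_mkcond [RHS]big_mkcond /=; apply: eq_bigr => j _.
    rewrite !finset.inE; case: (j == i) => /=; rewrite ?andbF ?andbT //.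
    by case: (boolP (j \in K)) => [/(fintype.subsetP KU) ->|] //; case: (_ \in _).
  apply: sumr_ge0 => i iU; apply: sumr_ge0 => j /andP[jU ji].
  by apply: sum_pairs_ge0; rewrite // eq_sym.
suff -> : mink_functional y =
    \sum_(U : {set 'I_d}) iter (d - #|U|) bdiff harmonic_ratio (#|U| - 2)%N * W U.
  by apply: sumr_ge0 => U _; rewrite mulr_ge0 // cm_harmonic_ratio.
rewrite /W; under eq_bigr => U _ do rewrite mulr_sumr big_mkcond /=.
rewrite exchange_big /mink_functional big_mkcond /=; apply: eq_bigr => K _.
(* Singletons contribute 0 to both sides, since h_0 = 0; the empty set is excluded from the
   functional and has weight 0 on the right. *)
rewrite -big_mkcond /=; case: (ltnP 1 #|K|) => K1; last first.
  rewrite big1 => [|U _].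
    case: ifP => // _; case: #|K| K1 => [|[]] //= _;
      by rewrite /harmonic_number big_ord0 mulr0.
  by case: #|K| K1 => [|[]] // _; rewrite ?mul0n ?muln0 !mulr0.
rewrite -mulr_suml harmonic_sum_subsets // -cards_eq0 -lt0n (ltnW K1).
case: #|K| K1 => [|[|n]] //= _; rewrite /harmonic_ratio subn2 /= natrM.
by have n0 := ler0n R n; field; nonzero.
Qed.

End Core.

(** * Alternating sums over chains of sets *)

Section SetSums.
Context {T : finType} {V : zmodType}.
Implicit Types (A B : {set T}) (f : T -> V).

Lemma sum_setU f A B :
  \sum_(i in (A :|: B)%SET) f i = \sum_(i in A) f i + \sum_(i in (B :\: A)%SET) f i.
Proof.
rewrite (bigID (fun i => i \in A)) /=; congr (_ + _); apply: eq_bigl => i.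
  by rewrite finset.inE; case: (i \in A); rewrite /= ?andbF ?andbT.
by rewrite !finset.inE; case: (i \in A); case: (i \in B).
Qed.

Lemma sum_setUI f A B :
  \sum_(i in (A :|: B)%SET) f i + \sum_(i in (A :&: B)%SET) f i =
  \sum_(i in A) f i + \sum_(i in B) f i.
Proof.
rewrite sum_setU -addrA; congr (_ + _).
by rewrite [RHS](big_setID A) /= finset.setIC addrC.
Qed.

End SetSums.

Section Chains.
Context {T : finType}.
Implicit Types (A B I J M : {set T}) (C F N : {set {set T}}).

Definition comparable_sets A B : bool := (A \subset B) || (B \subset A).

Definition comparable_to F A : bool := [forall B in F, comparable_sets A B].

Definition chain C : bool := [forall A in C, comparable_to C A].

Lemma comparable_toP F A :
  reflect (forall B, B \in F -> comparable_sets A B) (comparable_to F A).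
Proof. exact: 'forall_implyP. Qed.

Lemma chainP C :
  reflect (forall A B, A \in C -> B \in C -> comparable_sets A B) (chain C).
Proof.
apply: (iffP 'forall_implyP) => [h A B /h/comparable_toP|h A AC]; first exact.
by apply/comparable_toP => B; exact: h.
Qed.

Lemma comparable_sets_sym A B : comparable_sets A B = comparable_sets B A.
Proof. by rewrite /comparable_sets orbC. Qed.

Lemma chain_sub C F : C \subset F -> chain F -> chain C.
Proof.
move=> /fintype.subsetP CF /chainP h; apply/chainP => A B /CF AF /CF; exact: h.
Qed.

Lemma chainU1 A C : chain (A |: C)%SET = chain C && comparable_to C A.
Proof.
apply/idP/andP => [h|[/chainP hC /comparable_toP hA]].
  split; first by apply: chain_sub h; exact: finset.subsetUr.
  apply/comparable_toP => B BC; apply: (chainP _ h); first exact: setU11.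
  by rewrite setU1r.
apply/chainP => B D /setU1P[->|BC] /setU1P[->|DC].
- by rewrite /comparable_sets subxx.
- exact: hA.
- by rewrite comparable_sets_sym hA.
- exact: hC.
Qed.

(** A member of maximal cardinality contains all the others. This lets [finset.cover] serve as the
    maximum of a chain. *)
Lemma cover_chain C : chain C -> C != finset.set0 -> finset.cover C \in C.
Proof.
move=> /chainP hC /set0Pn[A0 A0C].
have [A AC Amax] := arg_maxnP (fun B => #|B|) A0C.
suff -> : finset.cover C = A by [].
apply/eqP; rewrite finset.eqEsubset (finset.bigcup_sup A) ?andbT //.
apply/finset.bigcupsP => B BC; case/orP: (hC _ _ AC BC) => // AB.
by have /eqP -> : A == B by rewrite eqEcard AB; exact: Amax.
Qed.

(** Minus the reduced Euler characteristic of the order complex of [N]; the empty chain contributes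
    1. *)
Definition chain_sum N : int :=
  \sum_(C : {set {set T}} | (C \subset N) && chain C) (-1) ^+ #|C|.

Lemma chain_sum0 : chain_sum finset.set0 = 1.
Proof.
rewrite /chain_sum (big_pred1 finset.set0) ?cards0 ?expr0 // => C.
rewrite finset.subset0 /=; have [->|//] := eqVneq C finset.set0.
by apply/chainP => A B; rewrite finset.inE.
Qed.

(** Removing [I] from the chains that contain it leaves the chains in the link of [I], with the sign
    reversed. *)
Lemma chain_sumU1 I N : I \notin N ->
  chain_sum (I |: N)%SET =
  chain_sum N - chain_sum [set A in N | comparable_sets A I].
Proof.
move=> IN; rewrite /chain_sum (bigID (fun C => I \in C)) /= addrC; congr (_ + _).
  apply: eq_bigl => C; rewrite andbAC; congr (_ && _).
  apply/andP/idP => [[CN IC]|CN].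
    by rewrite -(setU1K IN) finset.subsetD1 CN.
  split; first by rewrite (fintype.subset_trans CN) // finset.subsetUr.
  by apply: contra IN; exact: fintype.subsetP.
rewrite -sumrN (reindex_onto (fun C => (I |: C)%SET) (fun C => (C :\ I)%SET)) /=; last first.
  by move=> C /andP[_ IC]; rewrite finset.setD1K.
apply: eq_big => [C|C].
  rewrite setU11 andbT chainU1 finset.subUset finset.sub1set setU11 /=.
  apply/idP/idP.
    move=> /andP[/andP[CIN /andP[cC /comparable_toP IC]] /eqP CI].
    have IC' : I \notin C by rewrite -CI !finset.inE eqxx.
    rewrite cC andbT; apply/fintype.subsetP => A AC; rewrite finset.inE comparable_sets_sym IC //.
    have := fintype.subsetP CIN A AC; case/setU1P => [AI|->] //.
    by rewrite AI (negbTE IC') in AC.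
  move=> /andP[/fintype.subsetP CN cC]; rewrite cC /=.
  have -> : comparable_to C I.
    apply/comparable_toP => A /CN; rewrite finset.inE comparable_sets_sym; by case/andP.
  have -> : (C \subset I |: N)%SET.
    by apply/fintype.subsetP => A /CN; rewrite !finset.inE => /andP[-> _]; rewrite orbT.
  rewrite /= setU1K //; apply: contra IN => /CN.
  by rewrite finset.inE => /andP[].
move=> /andP[_ /eqP CI]; have IC' : I \notin C by rewrite -CI !finset.inE eqxx.
by rewrite cardsU1 IC' add1n exprS mulN1r.
Qed.

(* The order complex of [N] is contractible: [A <= A :|: M >= M]. On chains,
   toggle [toggled C], the join with [M] of the largest member of [C] not
   containing [M]. *)
Lemma chain_sum_cone M N : M \in N ->
  (forall A, A \in N -> (A :|: M)%SET \in N) -> chain_sum N = 0.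
Proof.
move=> MN NM.
pose low C := [set B in C | ~~ (M \subset B)].
pose toggled C := (finset.cover (low C) :|: M)%SET.
pose phi C := if toggled C \in C then (C :\ toggled C)%SET else (toggled C |: C)%SET.
(* Sets above [M] do not affect [low], so toggling preserves [toggled] and [phi] is an
   involution. *)
have lowE C (D : {set T}) : M \subset D -> low (D |: C)%SET = low C.
  move=> MD; apply/setP => B; rewrite !finset.inE andb_orl.
  by case: eqP => //= ->; rewrite MD andbF.
have lowDE C (D : {set T}) : M \subset D -> low (C :\ D)%SET = low C.
  move=> MD; apply/setP => B; rewrite !finset.inE.
  by case: eqP => //= ->; rewrite MD andbF.
have Mtog C : M \subset toggled C by exact: finset.subsetUr.
have togphi C : toggled (phi C) = toggled C.
  by rewrite /toggled /phi; case: ifP => _; rewrite ?lowE ?lowDE.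
have phiK : involutive phi.
  move=> C; rewrite {1}/phi togphi; case: (boolP (toggled C \in C)) => tC.
    have -> : phi C = (C :\ toggled C)%SET by rewrite /phi tC.
    by rewrite !finset.inE eqxx /= finset.setD1K.
  have -> : phi C = (toggled C |: C)%SET by rewrite /phi (negbTE tC).
  by rewrite setU11 finset.setU1K.
have phi_good C : (C \subset N) && chain C -> (phi C \subset N) && chain (phi C).
  case/andP=> CN cC; rewrite /phi; case: ifP => tC.
    have sC : (C :\ toggled C \subset C)%SET by exact: finset.subD1set.
    by rewrite (fintype.subset_trans sC CN) (chain_sub sC cC).
  have low_sub : low C \subset C.
    by apply/fintype.subsetP => B; rewrite finset.inE => /andP[].
  have clow := chain_sub low_sub cC.
  apply/andP; split.
    rewrite finset.subUset finset.sub1set CN andbT /toggled.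
    have [->|l0] := eqVneq (low C) finset.set0.
      by rewrite /finset.cover big_set0 finset.set0U.
    by apply/NM/(fintype.subsetP CN)/(fintype.subsetP low_sub)/cover_chain.
  rewrite chainU1 cC /=; apply/comparable_toP => B BC.
  (* A member above [M] contains all of [low C], hence [toggled C]; any other member lies in
     [low C], hence below it. *)
  case: (boolP (M \subset B)) => MB; apply/orP; [left|right].
    rewrite finset.subUset MB andbT; apply/finset.bigcupsP => A; rewrite finset.inE => /andP[AC MA].
    case/orP: (chainP _ cC _ _ AC BC) => // BA.
    by rewrite (fintype.subset_trans MB BA) in MA.
  apply: (fintype.subset_trans _ (finset.subsetUl _ _)).
  by apply: finset.bigcup_sup; rewrite finset.inE BC.
have : chain_sum N = - chain_sum N; last by lia.
rewrite {1}/chain_sum (reindex_inj (inv_inj phiK)) /= -sumrN.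
apply: eq_big => [C|C _].
  by apply/idP/idP => [/phi_good|/phi_good //]; rewrite phiK.
rewrite /phi; case: ifP => tC; last by rewrite cardsU1 tC exprS mulN1r.
by rewrite [in RHS](cardsD1 (toggled C) C) tC exprS mulN1r opprK.
Qed.

End Chains.

(** * A polynomial count of lattice points *)

Section FiniteSupportSums.
Context {I : choiceType} {V : zmodType}.
Implicit Types (A : set I) (f g : I -> V).

(** A sum with infinite support is 0 by convention, hence the hypotheses; all three sums are
    compared over the union [D] of the two supports. *)
Lemma fsumrB A f g : finite_set (A `&` f @^-1` [set~ 0]) ->
  finite_set (A `&` g @^-1` [set~ 0]) ->
  \sum_(x \in A) (f x - g x) = \sum_(x \in A) f x - \sum_(x \in A) g x.
Proof.
move=> ff fg; pose D := A `&` (f @^-1` [set~ 0] `|` g @^-1` [set~ 0]).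
have fD : finite_set D by rewrite /D classical_sets.setIUr finite_setU.
have DA : D `<=` A by move=> x [].
have out x : (A `\` D) x -> f x = 0 /\ g x = 0.
  move=> [Ax nD]; split; apply: contrapT => h; apply: nD; split=> //; by [left|right].
rewrite -!(fsbig_widen D A) //; last first.
- by move=> x /out[fx gx]; rewrite /preimage /= fx gx subr0.
- by move=> x /out[].
- by move=> x /out[].
by rewrite !fsbig_finite // sumrB.
Qed.

End FiniteSupportSums.

Section Counting.
Context {T : finType}.
Implicit Types (A B I J M : {set T}) (F N : {set {set T}}).
Implicit Types (x : {ffun T -> int}) (z : {ffun {set T} -> int}).

Definition set_sum x A : int := \sum_(i in A) x i.

(** Only sets that can extend the flag [F] are kept, so that enlarging [F] by [I] amounts to passing
    to the link of [I]. *)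
Definition violated F z x : {set {set T}} :=
  [set I | [&& I != finset.set0, I \notin F, comparable_to F I & z I < set_sum x I]].

Definition tight_points F z : set {ffun T -> int} :=
  [set x | forall J, J \in F -> set_sum x J = z J].

(* For submodular [z] and [F = [set setT]] this counts the lattice points of
   the base polytope of [z]; unlike that count, it is a polynomial function of
   all the coordinates of [z]. *)
Definition euler_count F z : int :=
  \sum_(x \in tight_points F z) chain_sum (violated F z x).

(** Containing [setT] fixes the total of a tight point, which turns upper bounds on its coordinates
    into lower bounds. *)
Definition flag F := [&& chain F, finset.set0 \notin F & [set: T]%SET \in F].

Lemma set_sumD x x' A : set_sum (x + x') A = set_sum x A + set_sum x' A.
Proof. by rewrite -big_split; apply: eq_bigr => i _; rewrite ffunE. Qed.

Lemma cover_below F A : chain F ->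
  let lo := finset.cover [set J in F | ~~ (A \subset J)] in
  (lo == finset.set0) || (lo \in F) && ~~ (A \subset lo).
Proof.
move=> cF /=; set L := [set J in F | _]%SET.
have LF : L \subset F by apply/fintype.subsetP => J; rewrite finset.inE => /andP[].
have [->|L0] := eqVneq L finset.set0; first by rewrite /finset.cover big_set0 eqxx.
by have := cover_chain (chain_sub LF cF) L0; rewrite [in X in X -> _]finset.inE orbC => ->.
Qed.

Lemma set_sumU_gt x A D j (B : int) : 0 <= B -> - B <= set_sum x A ->
  (forall k, k \in (D :\: A)%SET -> B *+ 2 < x k) ->
  j \in D -> j \notin A -> B < set_sum x (A :|: D)%SET.
Proof.
move=> B0 sA xD jD jA; rewrite /set_sum sum_setU.
have jDA : j \in (D :\: A)%SET by rewrite finset.inE jD jA.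
rewrite [X in _ + X](bigD1 j) //= -/(set_sum x A).
have : 0 <= \sum_(k in (D :\: A)%SET | k != j) x k.
  by apply: sumr_ge0 => k /andP[/xD xk _]; apply: le_trans (ltW xk); rewrite mulrn_wge0.
by move: (xD _ jDA) sA B0; clear; move: (\sum_(_ | _) _) => S; lia.
Qed.

(** The violated sets form a cone with apex [M] in the sense of [chain_sum_cone]: a coordinate above
    2B outweighs a sum that is at least -B, so joining with [M] gives x-sum above B, which forces
    violation. *)
Lemma chain_sum_violated_bounded F z x (B : int) : flag F ->
  (forall I, `|z I| <= B) -> tight_points F z x ->
  (exists i, B *+ 2 < x i) -> chain_sum (violated F z x) = 0.
Proof.
move=> /and3P[cF F0 FT] zB xF [i xi].
have B0 : 0 <= B by apply: le_trans (zB finset.set0).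
have zB1 I : z I <= B by have := zB I; lia.
have zB2 I : - B <= z I by have := zB I; lia.
pose lo := finset.cover [set J in F | ~~ ([set i] \subset J)]%SET.
have loP : (lo == finset.set0) || (lo \in F) && ~~ ([set i]%SET \subset lo) := cover_below _ cF.
have [hi /andP[hiF ihi] himin] := arg_minnP (P := fun J => (J \in F) && (i \in J)) (fun J => #|J|)
  (introT andP (conj FT (finset.in_setT i))).
have hi_sub J : J \in F -> i \in J -> hi \subset J.
  move=> JF iJ; case/orP: (chainP _ cF _ _ hiF JF) => // Jhi.
  by have /eqP -> : J == hi by rewrite eqEcard Jhi himin // JF.
have lo_sup J : J \in F -> i \notin J -> J \subset lo.
  by move=> JF iJ; apply: finset.bigcup_sup; rewrite !finset.inE JF finset.sub1set.
have ilo : i \notin lo.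
  by case/orP: loP => [/eqP ->|/andP[_]]; rewrite ?finset.inE // finset.sub1set.
have lohi : lo \subset hi.
  case/orP: loP => [/eqP ->|/andP[loF _]]; first exact: finset.sub0set.
  by case/orP: (chainP _ cF _ _ loF hiF) => // /fintype.subsetP /(_ _ ihi) ilo'; rewrite ilo' in ilo.
have sumlo : - B <= set_sum x lo.
  case/orP: loP => [/eqP ->|/andP[loF _]]; first by rewrite /set_sum big_set0 oppr_le0.
  by rewrite xF.
(* [lo] is the largest member of [F] missing i (or empty) and [hi] the smallest one containing i;
   any set between them is comparable to [F]. *)
pose M := (lo :|: [set j in hi | B *+ 2 < x j])%SET.
have iM : i \in M by rewrite !finset.inE ihi xi orbT.
have Mhi : M \subset hi.
  by rewrite finset.subUset lohi; apply/fintype.subsetP => j; rewrite finset.inE => /andP[].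
have Mlt : B < set_sum x M.
  apply: (set_sumU_gt (B := B) (j := i)) => //; last by rewrite finset.inE ihi.
  by move=> k; rewrite !finset.inE => /and3P[].
have M0 : M != finset.set0 by apply/set0Pn; exists i.
have MF : comparable_to F M.
  apply/comparable_toP => J JF; case: (boolP (i \in J)) => iJ; apply/orP; [left|right].
    exact: fintype.subset_trans Mhi (hi_sub _ _ _).
  exact: fintype.subset_trans (lo_sup _ JF iJ) (finset.subsetUl _ _).
have viol I : B < set_sum x I -> (z I < set_sum x I) && (I \notin F).
  move=> BI; rewrite (le_lt_trans (zB1 I) BI) /=; apply/negP => IF.
  by move: BI; rewrite xF // ltNge zB1.
apply: (@chain_sum_cone _ M).
  by rewrite finset.inE M0 MF /=; have /andP[-> ->] := viol _ Mlt.
move=> A; rewrite finset.inE => /and4P[A0 AF cA zA].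
case: (boolP (M \subset A)) => [/finset.setUidPl ->|MA].
  by rewrite finset.inE A0 AF cA.
have sAM : B < set_sum x (A :|: M)%SET.
  (* If [A] contains [lo], then [M] adds only coordinates above 2B to it; otherwise [A] lies inside
     [lo] and the join is [M] itself. *)
  case: (boolP (lo \subset A)) => loA.
    have /subsetPn[j jM jA] := MA.
    apply: (set_sumU_gt (B := B) (j := j)) => //; first exact: le_trans (zB2 A) (ltW zA).
    move=> k; rewrite !finset.inE => /andP[kA /orP[klo|/andP[_ //]]].
    by rewrite (fintype.subsetP loA) in kA.
  have Alo : A \subset lo.
    case/orP: loP => [/eqP lo0|/andP[loF _]]; first by rewrite lo0 finset.sub0set in loA.
    by have := comparable_toP _ _ cA _ loF; rewrite /comparable_sets (negbTE loA) orbF.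
  have /finset.setUidPr -> // : A \subset M.
  exact: fintype.subset_trans Alo (finset.subsetUl _ _).
rewrite finset.inE; have /andP[-> ->] := viol _ sAM; rewrite andbT /=.
apply/andP; split.
  by apply/set0Pn; exists i; rewrite finset.inE iM orbT.
apply/comparable_toP => J JF; case: (boolP (i \in J)) => iJ.
  case/orP: (comparable_toP _ _ cA _ JF) => [AJ|JA]; apply/orP; [left|right].
    by rewrite finset.subUset AJ (fintype.subset_trans Mhi) // hi_sub.
  exact: fintype.subset_trans JA (finset.subsetUl _ _).
apply/orP; right.
apply: fintype.subset_trans (lo_sup _ JF iJ) _.
by rewrite (fintype.subset_trans _ (finset.subsetUr _ _)) // finset.subsetUl.
Qed.

Lemma finite_bounded_ffun (k : nat) : finite_set [set x : {ffun T -> int} | forall i, `|x i| <= k%:Z].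
Proof.
pose h (f : {ffun T -> 'I_(k.*2.+1)}) : {ffun T -> int} := [ffun i => (f i)%:Z - k%:Z].
apply: (@sub_finite_set _ _ (h @` setT)); last exact/finite_image/finite_finset.
move=> x xk; exists [ffun i => inord (absz (x i + k%:Z))] => //.
apply/ffunP => i; rewrite !ffunE inordK; first by have := xk i; lia.
by have := xk i; lia.
Qed.

Lemma finite_euler_count F z : flag F ->
  finite_set (tight_points F z `&`
    (fun x => chain_sum (violated F z x)) @^-1` [set~ 0]).
Proof.
move=> fF; pose B : int := \sum_I `|z I|.
have zB I : `|z I| <= B by rewrite /B (bigD1 I) //= lerDl sumr_ge0.
have B0 : 0 <= B by apply: le_trans (zB finset.set0).
(* Each coordinate is at most 2B, and the total is at least -B, so each coordinate is at least -B -
   2B|T|. *)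
pose k := absz (B + B *+ 2 *+ #|T|).
apply: sub_finite_set (finite_bounded_ffun k) => x /= [xF xN] i.
have up j : x j <= B *+ 2.
  rewrite leNgt; apply/negP => xj; apply: xN.
  by apply: (chain_sum_violated_bounded fF zB xF); exists j.
have /and3P[_ _ FT] := fF.
have := xF _ FT; rewrite /set_sum (bigD1 i) ?finset.inE //= => E.
have : \sum_(j in [set: T]%SET | j != i) x j <= B *+ 2 *+ #|T|.
  apply: (@le_trans _ _ (\sum_(j : T) B *+ 2)); last by rewrite sumr_const.
  rewrite big_mkcond; apply: ler_sum => j _; by case: ifP => // _; rewrite mulrn_wge0.
have := zB [set: T]%SET; have := up i.
have : B *+ 2 <= B *+ 2 *+ #|T|.
  have : (0 < #|T|)%N by apply/card_gt0P; exists i.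
  by case: #|T| => // n _; rewrite [leRHS]mulrS lerDl !mulrn_wge0.
rewrite /k; move: E B0; clear; move: (\sum_(_ | _) _) => S.
move: (B *+ 2 *+ #|T|) (z _) => Y Z; lia.
Qed.

Definition unit_at I : {ffun {set T} -> int} := [ffun J => (J == I)%:R].

(** Raising z(I) by 1 changes the violated sets only at points with x(I) equal to the new value:
    there [I] ceases to be violated, and [chain_sumU1] evaluates the change. *)
Lemma euler_countU1 F z I : flag F -> I != finset.set0 -> I \notin F ->
  comparable_to F I ->
  euler_count F (z + unit_at I) - euler_count F z = euler_count (I |: F)%SET (z + unit_at I).
Proof.
move=> fF I0 IF cI; set z' := z + unit_at I.
have zz' J : J != I -> z' J = z J by move=> /negbTE JI; rewrite !ffunE JI addr0.
have z'I : z' I = z I + 1 by rewrite !ffunE eqxx.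
have tE : tight_points F z' = tight_points F z.
  by apply/seteqP; split=> x h J JF; move: (h _ JF); rewrite zz' //; apply: contraNneq IF => <-.
rewrite /euler_count -tE -fsumrB; [|exact: finite_euler_count|]; last first.
  by rewrite tE; exact: finite_euler_count.
have -> : tight_points (I |: F)%SET z' = tight_points F z' `&` [set x | set_sum x I = z' I].
  apply/seteqP; split=> x.
    by move=> h; split=> [J JF|]; apply: h; rewrite ?setU11 // setU1r.
  by move=> [h xI] J /setU1P[->|/h].
rewrite fsbig_mkcondr; apply: eq_fsbigr => x _.
case: ifPn; rewrite !(classical_sets.inE, notin_setE) /= => xI.
  have -> : violated F z x = (I |: violated F z' x)%SET.
    apply/setP => J; rewrite !finset.inE.
    have [->|JI] := eqVneq J I; first by rewrite I0 IF cI xI z'I ltrDl.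
    by rewrite zz'.
  rewrite chain_sumU1; last by rewrite finset.inE xI ltxx !andbF.
  rewrite opprB addrCA subrr addr0; congr chain_sum.
  apply/setP => J; rewrite !finset.inE.
  have [->|JI] := eqVneq J I; first by rewrite xI ltxx /= !andbF.
  have -> : comparable_to (I |: F)%SET J = comparable_sets J I && comparable_to F J.
    apply/comparable_toP/andP => [h|[h1 /comparable_toP h2] K /setU1P[->|/h2] //].
    by split; [apply: h; rewrite setU11 | apply/comparable_toP => K KF; apply: h; rewrite setU1r].
  by case: (J != _); case: (J \in F); case: (comparable_to F J);
     case: (comparable_sets J I); case: (z' J < _).
suff -> : violated F z x = violated F z' x by rewrite subrr.
apply/setP => J; rewrite !finset.inE; have [->|JI] := eqVneq J I; last by rewrite zz'.
rewrite z'I; do 3!congr (_ && _); move/eqP: xI; rewrite z'I; lia.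
Qed.

Lemma euler_count_indep F z I : I \notin F ->
  (I == finset.set0) || ~~ comparable_to F I ->
  euler_count F (z + unit_at I) = euler_count F z.
Proof.
move=> IF hI; set z' := z + unit_at I.
have zz' J : J != I -> z' J = z J by move=> /negbTE JI; rewrite !ffunE JI addr0.
have tE : tight_points F z' = tight_points F z.
  by apply/seteqP; split=> x h J JF; move: (h _ JF); rewrite zz' //; apply: contraNneq IF => <-.
rewrite /euler_count tE; apply: eq_fsbigr => x _; congr chain_sum.
apply/setP => J; rewrite !finset.inE; have [->|JI] := eqVneq J I; last by rewrite zz'.
by case/orP: hI => [-> //|/negbTE ->]; rewrite /= !andbF.
Qed.

(** Translation of the points by [x0]. It supplies the directions needed for the coordinates in [F],
    which [euler_countU1] does not reach. *)
Lemma euler_count_shift F z x0 :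
  euler_count F (z + [ffun J => set_sum x0 J]) = euler_count F z.
Proof.
rewrite /euler_count (reindex_fsbig (fun x => x + x0) (tight_points F z)).
  apply: eq_fsbigr => x _; congr chain_sum; apply/setP => J.
  by rewrite !finset.inE !ffunE set_sumD ltrD2r.
split.
- by move=> x h J JF; rewrite set_sumD !ffunE h.
- by move=> x x' _ _ /addIr.
- move=> x h; exists (x - x0); last by rewrite subrK.
  move=> J JF; have := h J JF; rewrite -{1}(subrK x0 x) set_sumD !ffunE.
  exact: addIr.
Qed.

End Counting.

(** * Polynomial maps on an abelian group *)

Section PolynomialMaps.
Context {V : zmodType}.
Implicit Types (f g : V -> int) (v w : V).

Definition fdiff w f : V -> int := fun v => f (v + w) - f v.

(* Polynomial maps of degree less than [n]: [n]-fold differences vanish. *)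
Fixpoint polymap n f : Prop :=
  if n is m.+1 then forall w, polymap m (fdiff w f) else forall v, f v = 0.

Lemma eq_polymap n f g : f =1 g -> polymap n f -> polymap n g.
Proof.
elim: n f g => [|n IH] f g fg /=; first by move=> h v; rewrite -fg.
by move=> h w; apply: IH (h w) => v; rewrite /fdiff !fg.
Qed.

Lemma polymap0 n : polymap n (fun=> 0).
Proof.
by elim: n => //= n IH w; apply: eq_polymap IH.
Qed.

Lemma polymapD n f g : polymap n f -> polymap n g ->
  polymap n (fun v => f v + g v).
Proof.
elim: n f g => [|n IH] f g /= hf hg; first by move=> v; rewrite hf hg addr0.
by move=> w; apply: eq_polymap (IH _ _ (hf w) (hg w)) => v; rewrite /fdiff; lia.
Qed.

Lemma polymapN n f : polymap n f -> polymap n (fun v => - f v).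
Proof.
elim: n f => [|n IH] f /= hf; first by move=> v; rewrite hf oppr0.
by move=> w; apply: eq_polymap (IH _ (hf w)) => v; rewrite /fdiff; lia.
Qed.

Lemma polymap_translate n f w : polymap n f -> polymap n (fun v => f (v + w)).
Proof.
elim: n f => [|n IH] f /= hf; first by move=> v; rewrite hf.
by move=> u; apply: eq_polymap (IH _ (hf u)) => v; rewrite /fdiff addrAC.
Qed.

Lemma polymapS n f : polymap n f -> polymap n.+1 f.
Proof.
elim: n f => [|n IH] f hf; last by move=> w; apply: IH.
by move=> w v; rewrite /fdiff !hf subrr.
Qed.

Lemma polymap_fdiff n f w : polymap n f -> polymap n (fdiff w f).
Proof. by move=> /polymapS; exact. Qed.

Lemma polymap_iter n k f w : polymap n f -> polymap n (iter k (fdiff w) f).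
Proof. by move=> hf; elim: k => //= k IH; exact: polymap_fdiff. Qed.

Section Directions.
Variables (n : nat) (f : V -> int).
(** The directions [w] with this property form a subgroup, so being polynomial can be checked on
    generators. *)
Let H w := polymap n (fdiff w f).

Lemma polymap_dir0 : H 0.
Proof. by apply: eq_polymap (polymap0 n) => v; rewrite /fdiff addr0 subrr. Qed.

Lemma polymap_dirD v w : H v -> H w -> H (v + w).
Proof.
move=> /(polymap_translate w) hv hw.
by apply: eq_polymap (polymapD hv hw) => u; rewrite /fdiff -(addrA u w v) (addrC w); ring.
Qed.

Lemma polymap_dirN v : H v -> H (- v).
Proof.
move=> /polymapN/(polymap_translate (- v)) hv.
by apply: eq_polymap hv => u; rewrite /fdiff subrK opprB.
Qed.

Lemma polymap_dirMn v k : H v -> H (v *+ k).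
Proof.
move=> hv; elim: k => [|k IH]; first by rewrite mulr0n; exact: polymap_dir0.
by rewrite mulrS; exact: polymap_dirD.
Qed.

Lemma polymap_dirMz v (k : int) : H v -> H (v *~ k).
Proof.
move=> hv; case: k => k; first exact: polymap_dirMn.
by rewrite NegzE mulrNz; apply/polymap_dirN/polymap_dirMn.
Qed.

Lemma polymap_dir_sum (I : Type) (r : seq I) (P : pred I) (v : I -> V) :
  (forall i, P i -> H (v i)) -> H (\sum_(i <- r | P i) v i).
Proof. by move=> h; elim/big_ind: _ => //; [exact: polymap_dir0|exact: polymap_dirD]. Qed.

End Directions.

(** Newton's forward difference formula, by Pascal's rule; it stops at n because the n-th difference
    vanishes. *)
Lemma newton n f w k v : polymap n f ->
  f (v + w *+ k) = \sum_(i < n) ('C(k, i))%:Z * iter i (fdiff w) f v.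
Proof.
move=> hf; case: n hf => [|n] hf; first by rewrite big_ord0 hf.
elim: k v => [|k IH] v.
  rewrite mulr0n addr0 big_ord_recl big1 ?addr0 ?mul1r // => i _.
  by rewrite bin_small ?mul0r.
rewrite mulrS addrA IH.
have top u : iter n.+1 (fdiff w) f u = 0.
  elim: (n.+1) f hf {IH} => [|m IHm] g hg //.
  by rewrite iterSr; apply: IHm.
have step i : iter i (fdiff w) f (v + w) = iter i (fdiff w) f v + iter i.+1 (fdiff w) f v.
  by rewrite iterS; move: (iter i _ _) => g; rewrite /fdiff; ring.
under eq_bigr => i _ do rewrite step mulrDr.
rewrite big_split /= [X in _ + X]big_ord_recr /= [X in _ + (_ + _ * X)](top v) mulr0 addr0.
rewrite big_ord_recl [RHS]big_ord_recl !bin0 -addrA; congr (_ + _).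
rewrite -big_split /=; apply: eq_bigr => i _.
by rewrite /bump /= !add1n binS PoszD mulrDl addrC.
Qed.

End PolynomialMaps.

(** * Linear coefficients of polynomial maps along rays *)

Section LinearCoefficient.
Context {R : realFieldType}.

Lemma poly_eq_nat (p q : {poly R}) :
  (forall n : nat, (0 < n)%N -> p.[n%:R] = q.[n%:R]) -> p = q.
Proof.
move=> pq; apply/eqP; rewrite -subr_eq0; apply/eqP.
apply: (@roots_geq_poly_eq0 _ _ [seq i.+1%:R | i <- iota 0 (size (p - q))]).
- by apply/allP => x /mapP[i _ ->]; rewrite rootE hornerD hornerN pq // subrr.
- rewrite map_inj_uniq ?iota_uniq // => i j /eqP.
  by rewrite eqr_nat eqSS => /eqP.
- by rewrite size_map size_iota.
Qed.

Definition bin_poly k : {poly R} := \prod_(i < k) (i.+1%:R^-1 *: ('X - i%:R%:P)).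

Lemma bin_polyE k n : (bin_poly k).[n%:R] = ('C(n, k))%:R.
Proof.
elim: k => [|k IH]; first by rewrite /bin_poly big_ord0 hornerC bin0.
rewrite /bin_poly big_ord_recr hornerM -/(bin_poly k) IH !hornerE /=.
apply: (@mulfI _ k.+1%:R); first by rewrite pnatr_eq0.
transitivity ('C(n, k)%:R * (n%:R - k%:R) : R).
  by field; rewrite addrC natr1 pnatr_eq0.
rewrite -natrM mul_bin_left natrM mulrC.
case: (leqP k n) => kn; first by rewrite natrB.
by rewrite bin_small // !mulr0.
Qed.

Lemma bin_poly_coef0 k : (bin_poly k)`_0 = (k == 0)%:R.
Proof. by rewrite -horner_coef0 (bin_polyE k 0) bin0n eq_sym. Qed.

Context {V : zmodType}.
Implicit Types (f : V -> int) (v w : V).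

Definition newton_poly n f v : {poly R} :=
  \sum_(i < n) (iter i (fdiff v) f 0)%:~R *: bin_poly i.

Definition lin_coef n f v : R := (newton_poly n f v)`_1.

Lemma newton_polyE n f v k : polymap n f ->
  (newton_poly n f v).[k%:R] = (f (v *+ k))%:~R.
Proof.
move=> hf; rewrite -(add0r (v *+ k)) (newton v k 0 hf) rmorph_sum horner_sum.
by apply: eq_bigr => i _; rewrite hornerZ bin_polyE rmorphM mulrC.
Qed.

Lemma lin_coefP n f v (p : {poly R}) : polymap n f ->
  (forall k : nat, (0 < k)%N -> p.[k%:R] = (f (v *+ k))%:~R) -> p`_1 = lin_coef n f v.
Proof.
move=> hf hp; suff -> : p = newton_poly n f v by []; apply: poly_eq_nat => k k0.
by rewrite hp // newton_polyE.
Qed.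

(** By Newton in direction w, f(kv + kw) is the sum of C(k,i) (D_w^i f)(kv), where D_w is [fdiff w].
    As C(k,i) has constant term 0 for i > 0, the linear coefficient splits into that of f along v
    and the sum of the linear coefficients of C(k,i) times (D_w^i f)(0), which is that of f along
    w. *)
Lemma lin_coefD n f v w : polymap n f ->
  lin_coef n f (v + w) = lin_coef n f v + lin_coef n f w.
Proof.
move=> hf.
pose p := \sum_(i < n) bin_poly i * newton_poly n (iter i (fdiff w) f) v.
rewrite -(@lin_coefP _ _ _ p) // => [|k _]; last first.
  rewrite mulrnDl (newton w k _ hf) rmorph_sum /p horner_sum.
  apply: eq_bigr => i _; rewrite hornerM bin_polyE newton_polyE; last exact: polymap_iter.
  by rewrite rmorphM.
have c0 i : (newton_poly n (iter i (fdiff w) f) v)`_0 = (iter i (fdiff w) f 0)%:~R.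
  by rewrite -horner_coef0 (newton_polyE v 0) ?mulr0n //; exact: polymap_iter.
rewrite /lin_coef /p coef_sum [newton_poly n f w]/newton_poly [X in _ + X]coef_sum.
under eq_bigr => i _ do
  rewrite coefM big_ord_recl big_ord1 /= bin_poly_coef0 c0.
rewrite big_split /=; congr (_ + _); last first.
  by apply: eq_bigr => i _; rewrite coefZ mulrC.
case: n hf {p c0} => [|n] hf; first by rewrite /newton_poly !big_ord0 coef0.
by rewrite big_ord_recl big1 ?mul1r ?addr0 // => i _; rewrite mul0r.
Qed.

Lemma lin_coefMz n f v (k : int) : polymap n f ->
  lin_coef n f (v *~ k) = lin_coef n f v * k%:~R.
Proof.
move=> hf.
have l0 : lin_coef n f 0 = 0.
  by have := lin_coefD 0 0 hf; rewrite addr0; move: (lin_coef _ _ _) => a; lra.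
have lN u : lin_coef n f (- u) = - lin_coef n f u.
  by have := lin_coefD u (- u) hf; rewrite subrr l0; lra.
have lM u m : lin_coef n f (u *+ m) = lin_coef n f u *+ m.
  by elim: m => [|m IH]; rewrite ?mulr0n // !mulrS lin_coefD // IH.
case: k => m; first by rewrite -pmulrn lM mulr_natr.
by rewrite NegzE mulrNz lN lM rmorphN mulrN /= mulr_natr.
Qed.

Lemma lin_coef_sum n f (I : Type) (r : seq I) (P : pred I) (v : I -> V) : polymap n f ->
  lin_coef n f (\sum_(i <- r | P i) v i) = \sum_(i <- r | P i) lin_coef n f (v i).
Proof.
move=> hf; elim/big_rec2: _ => [|i y x _ <-]; last exact: lin_coefD.
by have := lin_coefMz 0 0 hf; rewrite mulr0z mulr0.
Qed.

End LinearCoefficient.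

(** * Polynomiality of the Euler count *)

Section EulerCountPolynomial.
Context {T : finType}.
Implicit Types (I J : {set T}) (F : {set {set T}}) (z : {ffun {set T} -> int}).

Lemma sum_unit_at (z : {ffun {set T} -> int}) : z = \sum_I unit_at I *~ z I.
Proof.
apply/ffunP => J; rewrite sum_ffunE (bigD1 J) //= big1 => [|I IJ]; rewrite ffunMzE ffunE.
  by rewrite eqxx addr0 intz.
by rewrite eq_sym (negbTE IJ) mul0rz.
Qed.

Lemma flagU1 F I : flag F -> I != finset.set0 -> comparable_to F I -> flag (I |: F)%SET.
Proof.
move=> /and3P[cF F0 FT] I0 cI; apply/and3P; split; first by rewrite chainU1 cF.
  by rewrite finset.in_setU1 negb_or eq_sym I0.
by rewrite setU1r.
Qed.

(** Here n is one more than the number of sets outside [F], so n = 0 cannot occur. A difference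
    along a coordinate outside [F] either vanishes or is the count for a larger flag, which the
    induction covers. *)
Lemma euler_count_polymap n F : flag F -> (n + #|F| = #|{set T}|.+1)%N ->
  polymap n (euler_count F).
Proof.
elim: n F => [|n IH] F fF nF.
  by have := max_card (mem F); rewrite -[#|F|]add0n nF ltnn.
pose H w := polymap n (fdiff w (euler_count F)).
have out I : I \notin F -> H (unit_at I).
  move=> IF; have [h|h] := boolP ((I == finset.set0) || ~~ comparable_to F I).
    apply: eq_polymap (polymap0 n) => z.
    by rewrite /fdiff euler_count_indep ?subrr.
  have /norP[I0 /negPn cI] := h.
  have hI : polymap n (euler_count (I |: F)%SET).
    by apply: IH; [exact: flagU1|rewrite cardsU1 IF addnCA add1n].
  by apply: eq_polymap (polymap_translate (unit_at I) hI) => z; rewrite /fdiff euler_countU1.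
have /and3P[cF F0 FT] := fF.
(* Coordinates in [F] are treated from the largest set downwards. *)
suff inF k I : (#|T| - #|I| < k)%N -> I \in F -> H (unit_at I).
  move=> w; rewrite (sum_unit_at w); apply: polymap_dir_sum => I _.
  apply: polymap_dirMz; case: (boolP (I \in F)) => [|/out //].
  exact: inF (leqnn _).
elim: k I => // k IHk I kI IF.
(* Translating the points by the unit vector of [a] moves [z] by 1 on exactly
   those members of [F] that contain [I]. *)
have [a aI alo] : exists2 a, a \in I & a \notin finset.cover [set J in F | ~~ (I \subset J)]%SET.
  have := cover_below I cF => /= /orP[/eqP ->|/andP[_ /subsetPn[a aI alo]]]; last by exists a.
  by have /set0Pn[a aI] : I != finset.set0 := memPn F0 _ IF; exists a; rewrite ?finset.inE.
pose x0 : {ffun T -> int} := [ffun i => (i == a)%:R].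
have x0E J : set_sum x0 J = (a \in J)%:R.
  rewrite /set_sum; case: (boolP (a \in J)) => aJ.
    rewrite (bigD1 a) //= big1 ?ffunE ?eqxx ?addr0 // => i /andP[_ /negbTE ia].
    by rewrite ffunE ia.
  rewrite big1 // => i iJ; rewrite ffunE; case: eqP => // ia.
  by rewrite -ia iJ in aJ.
have Hs : H [ffun J => set_sum x0 J].
  by apply: eq_polymap (polymap0 n) => z; rewrite /fdiff euler_count_shift subrr.
have -> : unit_at I = [ffun J => set_sum x0 J]
    - \sum_(J | J != I) unit_at J *~ [ffun J => set_sum x0 J] J.
  rewrite [X in _ = X - _]sum_unit_at (bigD1 I) //= addrK ffunE x0E aI.
  by rewrite mulr1z.
apply: polymap_dirD => //; apply: polymap_dirN; apply: polymap_dir_sum => J JI.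
rewrite ffunE x0E; case: (boolP (a \in J)) => aJ; last by rewrite mulr0z; exact: polymap_dir0.
rewrite mulr1z; case: (boolP (J \in F)) => [JF|/out //].
have IJ : I \subset J.
  apply: contraNT alo => IJ; apply/finset.bigcupP; exists J => //.
  by rewrite finset.inE JF.
apply: IHk => //; have : I \proper J by rewrite finset.properEneq eq_sym JI.
move=> /proper_card IJc; move: kI IJc (max_card (mem J) : #|J| <= #|T|)%N.
by clear; move: #|I| #|J| #|T| => p q r; lia.
Qed.

End EulerCountPolynomial.

(** * Lattice points of base polytopes *)

Section BasePolytope.
Context {T : finType}.
Implicit Types (I J K : {set T}) (x : {ffun T -> int}) (z : {ffun {set T} -> int}).

Definition base_points z : set {ffun T -> int} :=
  [set x | set_sum x [set: T]%SET = z [set: T]%SET /\ forall I, set_sum x I <= z I].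

Let top : {set {set T}} := [set [set: T]%SET]%SET.

Lemma set_sumUI x I J :
  set_sum x (I :|: J)%SET + set_sum x (I :&: J)%SET = set_sum x I + set_sum x J.
Proof. exact: sum_setUI. Qed.

(** At a point outside the base polytope, let [M] minimise g(J) = z(J) - x(J) over all J.
    Submodularity gives g(A + M) <= g(A) + g(M) - g(A & M) <= g(A), with + for union and & for
    intersection, so the violated sets are closed under joining [M] and form a cone. At a base point
    nothing is violated. *)
Lemma euler_count_submodular z : submodular z -> z finset.set0 = 0 ->
  euler_count top z = \sum_(x \in base_points z) (1 : int).
Proof.
move=> sub z0.
have -> : base_points z = tight_points top z `&` [set x | forall I, set_sum x I <= z I].
  apply/seteqP; split=> x [xT xz]; split=> //.
    by move=> J /set1P ->.
  by apply: xT; rewrite finset.inE.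
rewrite fsbig_mkcondr; apply: eq_fsbigr => x; rewrite classical_sets.inE => xF.
have xT : set_sum x [set: T]%SET = z [set: T]%SET by apply: xF; rewrite finset.inE.
case: ifPn; rewrite ?(classical_sets.inE, notin_setE) /= => hx.
  suff -> : violated top z x = finset.set0 by rewrite chain_sum0.
  by apply/setP => I; rewrite !finset.inE ltNge hx !andbF.
have [I zI] : exists I, z I < set_sum x I.
  by apply: contrapT => h; apply: hx => I; rewrite leNgt; apply/negP => zI; apply: h; exists I.
pose g J := z J - set_sum x J.
have [M _ Mmin] := @arg_minP _ _ _ I predT g isT.
have gM : g M < 0 by apply: le_lt_trans (Mmin I isT) _; rewrite subr_lt0.
have viol J : g J < 0 -> J \in violated top z x.
  move=> gJ; rewrite !finset.inE -subr_lt0 gJ andbT; apply/and3P; split.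
  - by apply: contraTneq gJ => ->; rewrite /g z0 /set_sum big_set0 subrr ltxx.
  - by apply: contraTneq gJ => ->; rewrite /g xT subrr ltxx.
  - by apply/comparable_toP => K /set1P ->; rewrite /comparable_sets finset.subsetT.
apply: (chain_sum_cone (viol _ gM)) => A Aviol; apply: viol.
move: Aviol; rewrite finset.inE => /and4P[_ _ _ zA].
have := sub A M; have := set_sumUI x A M; have := Mmin (A :&: M)%SET isT.
by rewrite /g; move: zA; clear; lia.
Qed.

Definition simplex_fun K : {ffun {set T} -> int} := [ffun I => (meets K I)%:R].

Lemma submodular_simplex_fun K n : submodular (simplex_fun K *+ n).
Proof.
move=> I J; rewrite !ffunMnE !ffunE -!mulrnDl lerMn2r; apply/orP; right.
rewrite /meets finset.setIUr finset.setU_eq0 negb_and.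
have [h|] := eqVneq (K :&: (I :&: J))%SET finset.set0.
  by case: (_ != _); case: (_ != _).
move=> /set0Pn[i]; rewrite !finset.inE => /and3P[iK iI iJ].
have -> : (K :&: I != finset.set0)%SET by apply/set0Pn; exists i; rewrite finset.inE iK.
have -> // : (K :&: J != finset.set0)%SET by apply/set0Pn; exists i; rewrite finset.inE iK.
Qed.

Lemma base_points_simplexE K n : base_points (simplex_fun K *+ n) =
  [set x | [/\ forall i, 0 <= x i, forall i, i \notin K -> x i = 0
    & \sum_(i in K) x i = (n * (K != finset.set0))%:Z] ].
Proof.
have sT x : set_sum x [set: T]%SET = \sum_i x i by apply: eq_bigl => i; rewrite finset.inE.
have s1 x i : set_sum x [set i]%SET = x i by rewrite /set_sum big_set1.
have zE I : (simplex_fun K *+ n) I = (n * meets K I)%:Z.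
  by rewrite ffunMnE ffunE -mulrnA mulnC pmulrn intz.
have KT : meets K [set: T]%SET = (K != finset.set0) by rewrite /meets finset.setIT.
apply/seteqP; split=> x /=.
  move=> [xT xz].
  have x0 i : 0 <= x i.
    (* The constraint on the complement of i bounds the other coordinates by the total. *)
    have := xz (~: [set i])%SET; have := set_sumUI x [set i]%SET (~: [set i])%SET.
    rewrite finset.setUCr finset.setICr s1 {2}/set_sum big_set0 xT !zE KT.
    have : meets K (~: [set i])%SET ==> (K != finset.set0).
      by apply/implyP => /set0Pn[j]; rewrite finset.inE => /andP[jK _]; apply/set0Pn; exists j.
    by case: (meets _ _); case: (K != _) => //= _; lia.
  have xK i : i \notin K -> x i = 0.
    move=> iK; apply/eqP; rewrite eq_le x0 andbT -s1 (le_trans (xz _)) // zE.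
    by rewrite /meets finset.setI_eq0 disjoint_sym disjoints1 negbK (negbTE iK) muln0.
  split=> //; rewrite -KT -zE -xT sT [RHS](bigID (fun i => i \in K)) /= [X in _ + X]big1 ?addr0 //.
move=> [x0 xK xn].
have sumK I : set_sum x I = \sum_(i in (K :&: I)%SET) x i.
  rewrite /set_sum (bigID (fun i => i \in K)) /= [X in _ + X]big1 ?addr0 //.
    by apply: eq_bigl => i; rewrite finset.inE andbC.
  by move=> i /andP[_ /xK].
split; first by rewrite sumK finset.setIT xn zE KT.
move=> I; rewrite sumK zE /meets.
have [->|KI] := eqVneq (K :&: I)%SET finset.set0; first by rewrite big_set0.
have K0 : K != finset.set0 by apply: contraNneq KI => ->; rewrite finset.set0I.
rewrite K0 in xn; rewrite -xn [leRHS](big_setID I) /= lerDl.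
by apply: sumr_ge0.
Qed.

Lemma count_simplex K n : K != finset.set0 ->
  \sum_(x \in base_points (simplex_fun K *+ n)) (1 : int) = ('C(n + #|K|.-1, #|K|.-1))%:Z.
Proof.
move=> K0; rewrite base_points_simplexE K0 muln1.
have /set0Pn[k0 k0K] := K0.
have cK : #|K| = #|K|.-1.+1 by rewrite prednK // card_gt0.
move: (#|K|.-1) cK => m cK.
(* Stars and bars: the points are the |K|-tuples of naturals with sum n, whose entries are at most
   n; [card_ord_partitions] counts them. *)
pose S := [set t : m.+1.-tuple 'I_n.+1 | (\sum_(i <- t) i == n)%N]%SET.
pose rk (i : T) : 'I_m.+1 := cast_ord cK (enum_rank_in k0K i).
pose vl (j : 'I_m.+1) : T := enum_val (cast_ord (esym cK) j).
have rkK j : rk (vl j) = j by rewrite /rk /vl enum_valK_in cast_ordKV.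
have vlK i : i \in K -> vl (rk i) = i by move=> iK; rewrite /rk /vl cast_ordK enum_rankK_in.
have vlin j : vl j \in K by exact: enum_valP.
pose h (t : m.+1.-tuple 'I_n.+1) : {ffun T -> int} :=
  [ffun i => if i \in K then (tnth t (rk i) : nat)%:Z else 0].
have sumvl (f : T -> int) : \sum_(i in K) f i = \sum_j f (vl j).
  rewrite (reindex_onto vl rk) /=; last exact: vlK.
  by apply: eq_bigl => j; rewrite vlin rkK eqxx.
rewrite (reindex_fsbig h [set` S]).
  have -> : [set` S] = [set` enum S] by apply/seteqP; split=> t /=; rewrite mem_enum.
  rewrite -fsbig_seq ?enum_uniq // big_enum /= sumr_const addnC -card_ord_partitions.
  by rewrite natz.
split.
- move=> t /=; rewrite finset.inE => /eqP tn; split.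
  + by move=> i; rewrite ffunE; case: ifP.
  + by move=> i /negbTE iK; rewrite ffunE iK.
  + rewrite sumvl -[in RHS]tn big_tuple.
    rewrite -natz natr_sum; apply: eq_bigr => j _; by rewrite ffunE vlin rkK natz.
- move=> t t' _ _ /ffunP tt'; apply: eq_from_tnth => j; apply: val_inj => /=.
  by have := tt' (vl j); rewrite !ffunE vlin rkK => -[].
- move=> x [x0 xK xn].
  have xle j : x (vl j) <= n.
    by rewrite -xn (bigD1 (vl j)) ?vlin //= lerDl sumr_ge0.
  have xin j : (absz (x (vl j)) < n.+1)%N by move: (xle j) (x0 (vl j)); clear; move: (x (vl j)) => a; lia.
  exists [tuple (inord (absz (x (vl j))) : 'I_n.+1) | j < m.+1].
    rewrite /= finset.inE big_tuple -eqz_nat -xn sumvl -natz natr_sum.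
    apply/eqP; apply: eq_bigr => j _; rewrite tnth_mktuple inordK //.
    by move: (x0 (vl j)); clear; move: (x (vl j)) => a; lia.
  apply/ffunP => i; rewrite ffunE; case: ifPn => [iK|/xK //].
  rewrite tnth_mktuple inordK // vlK //.
  by move: (x0 i); clear; move: (x i) => a; lia.
Qed.

End BasePolytope.

(** * Linear Ehrhart coefficients of simplices and base polytopes *)

Section LinearCoefficientOfSimplex.
Context {R : realType}.

(** C(n+k, k) is the product of 1 + n/i for i = 1, ..., k. *)
Lemma simplex_ehrhart_lin k (p : {poly R}) :
  (forall n : nat, (0 < n)%N -> p.[n%:R] = ('C(n + k, k))%:R) -> p`_1 = harmonic_number k.
Proof.
move=> hp; pose q m : {poly R} := \prod_(i < m) (i.+1%:R^-1 *: 'X + 1).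
have qS m : q m.+1 = q m * (m.+1%:R^-1 *: 'X + 1) by rewrite /q big_ord_recr.
have qE m n : (q m).[n%:R] = ('C(n + m, m))%:R.
  elim: m => [|m IH]; first by rewrite /q big_ord0 hornerC addn0 bin0.
  rewrite qS hornerM IH !hornerE.
  apply: (@mulfI _ m.+1%:R); first by rewrite pnatr_eq0.
  rewrite addnS -[in RHS]natrM -mul_bin_diag natrM /= -addnS natrD.
  by field; rewrite addrC natr1 pnatr_eq0.
have q0 m : (q m)`_0 = 1 by rewrite -horner_coef0 (qE m 0) add0n binn.
have -> : p = q k by apply: poly_eq_nat => n n0; rewrite hp // qE.
elim: k {hp} => [|m IH]; first by rewrite /q big_ord0 /harmonic_number big_ord0 coef1.
rewrite qS harmonicS coefM big_ord_recl big_ord1 /= IH q0.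
rewrite !coefD !coefZ !coefX !coef1 /=; by ring.
Qed.

Context {T : finType}.
Implicit Types (K I : {set T}) (z : {ffun {set T} -> int}).

Theorem base_ehrhart_lin z (y : {set T} -> int) (p : {poly R}) :
  [set: T]%SET != finset.set0 ->
  (forall I, z I = \sum_(K | K != finset.set0) y K * (meets K I)%:R) ->
  submodular z ->
  (forall n : nat, (0 < n)%N -> p.[n%:R] = (\sum_(x \in base_points (z *+ n)) (1 : int))%:~R) ->
  p`_1 = \sum_(K : {set T} | K != finset.set0) (y K)%:~R * harmonic_number #|K|.-1.
Proof.
move=> T0 zy sub hp.
set top : {set {set T}} := [set [set: T]%SET]%SET.
have ftop : flag top.
  apply/and3P; split; last by rewrite finset.inE.
    by apply/chainP => A B /set1P -> /set1P ->; rewrite /comparable_sets subxx.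
  by rewrite finset.inE eq_sym.
have hpoly : polymap #|{set T}| (euler_count top).
  by apply: euler_count_polymap => //; rewrite cards1 addn1.
have zn0 n : (z *+ n) finset.set0 = 0.
  rewrite ffunMnE zy big1 ?mul0rn // => K _.
  by rewrite /meets finset.setI0 eqxx mulr0.
rewrite (lin_coefP (v := z) hpoly) => [|n n0]; last first.
  rewrite hp // euler_count_submodular // => I J.
  by rewrite !ffunMnE -!mulrnDl lerMn2r sub orbT.
(* Coefficients may be negative and partial sums not submodular; additivity still applies because
   [euler_count] is polynomial on the whole group. *)
have -> : z = \sum_(K : {set T} | K != finset.set0) simplex_fun K *~ y K.
  apply/ffunP => I; rewrite zy sum_ffunE; apply: eq_bigr => K _.
  by rewrite ffunMzE ffunE -mulrzr intz mulrC.
rewrite lin_coef_sum //; apply: eq_bigr => K K0.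
rewrite lin_coefMz // mulrC; congr (_ * _).
rewrite -(simplex_ehrhart_lin (p := newton_poly #|{set T}| (euler_count top) (simplex_fun K))) // => n _.
rewrite newton_polyE // euler_count_submodular.
- by rewrite count_simplex.
- exact: submodular_simplex_fun.
- by rewrite ffunMnE ffunE /meets finset.setI0 eqxx mul0rn.
Qed.

End LinearCoefficientOfSimplex.

(** * Generalized permutahedra as base polytopes *)

Section Orders.
Context {d : nat}.
Implicit Types (tau : 'S_d) (A B V W : {set 'I_d}).

Definition initial tau A : Prop := forall i j, i \in A -> j \notin A -> (tau i < tau j)%N.

Lemma exists_order (f : 'I_d -> nat) :
  exists tau : 'S_d, forall i j, (f i < f j)%N -> (tau i < tau j)%N.
Proof.
(* Sort by [f], breaking ties by index; the position of i is the number of elements before it. *)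
pose F (i : 'I_d) := (f i * d + i)%N.
have Flt (i j : 'I_d) : (f i < f j)%N -> (F i < F j)%N.
  move=> fij; rewrite /F (@leq_trans ((f i).+1 * d)) //.
    by rewrite mulSn addnC ltn_add2r.
  by rewrite (leq_trans _ (leq_addr _ _)) // leq_mul2r fij orbT.
have Finj : injective F.
  move=> i j Fij; have : f i = f j.
    by case: (ltngtP (f i) (f j)) => // /Flt; rewrite Fij ltnn.
  by move=> fij; apply: val_inj; move: Fij; rewrite /F fij => /addnI.
pose S i := [set j | (F j < F i)%N]%SET.
have Sd i : (#|S i| < d)%N.
  rewrite -[X in (_ < X)%N](card_ord d) -cardsT proper_card // properE finset.subsetT /=.
  by apply/subsetPn; exists i; rewrite !finset.inE ?ltnn.
have Slt i j : (F i < F j)%N -> (#|S i| < #|S j|)%N.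
  move=> Fij; rewrite proper_card // properE; apply/andP; split.
    by apply/fintype.subsetP => k; rewrite !finset.inE => /ltn_trans; apply.
  by apply/subsetPn; exists i; rewrite !finset.inE ?ltnn.
have rinj : injective (fun i => Ordinal (Sd i)).
  move=> i j [Sij]; apply: Finj.
  by case: (ltngtP (F i) (F j)) => // /Slt; rewrite Sij ltnn.
by exists (perm rinj) => i j /Flt/Slt; rewrite !permE.
Qed.

(** List [A] first, then the rest of [B], then the remaining elements. *)
Lemma exists_initial2 A B : A \subset B ->
  exists tau, initial tau A /\ initial tau B.
Proof.
move=> AB; have [tau htau] := exists_order (fun i => (i \notin A) + (i \notin B))%N.
exists tau; split=> i j iX jX; apply: htau.
  by rewrite iX jX (fintype.subsetP AB _ iX); case: (j \in B).
by rewrite iX jX (contra (fintype.subsetP AB j) jX); case: (i \in A).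
Qed.

(** V - W and W - V have equally many elements, and the least element m of W - V exceeds everything
    in V - W. *)
Lemma sum_upper_set V W : #|V| = #|W| ->
  (forall w v, w \in W -> v \notin W -> (v < w)%N) ->
  (\sum_(i in V) i <= \sum_(i in W) i)%N.
Proof.
move=> cVW up; rewrite (big_setID W) [leqRHS](big_setID V) /= finset.setIC leq_add2l.
have cD : #|(V :\: W)%SET| = #|(W :\: V)%SET|.
  apply: (@addnI #|(V :&: W)%SET|); rewrite cardsID finset.setIC cardsID; exact: cVW.
have [W0|/set0Pn[w0 w0W]] := eqVneq (W :\: V)%SET finset.set0.
  rewrite W0 big_set0; have -> : (V :\: W)%SET = finset.set0.
    by apply/eqP; rewrite -cards_eq0 cD W0 cards0.
  by rewrite big_set0.
have [m mW mmin] := arg_minnP (P := fun i => i \in (W :\: V)%SET) (fun i : 'I_d => i : nat) w0W.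
apply: (@leq_trans (\sum_(i in (V :\: W)%SET) m)%N).
  apply: leq_sum => i; rewrite !finset.inE => /andP[iW _]; apply/ltnW/up => //.
  by move: mW; rewrite finset.inE => /andP[].
by rewrite sum_nat_const cD -sum_nat_const; apply: leq_sum.
Qed.

Lemma sum_perm_le (s tau : 'S_d) A : initial tau A ->
  (\sum_(i in A) s i <= \sum_(i in A) rev_ord (tau i))%N.
Proof.
move=> hA; pose r i := rev_ord (tau i).
have rinj : injective r by move=> i j /rev_ord_inj/perm_inj.
have -> : (\sum_(i in A) s i = \sum_(i in s @: A) i)%N.
  by rewrite big_imset //= => i j _ _ /perm_inj.
have -> : (\sum_(i in A) rev_ord (tau i) = \sum_(i in r @: A) i)%N.
  by rewrite big_imset //= => i j _ _ /rinj.
apply: sum_upper_set; first by rewrite !card_imset //; exact: perm_inj.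
move=> _ v /imsetP[i iA ->] vA; pose j := (tau^-1)%g (rev_ord v).
have vE : v = r j by rewrite /r /j permKV rev_ordK.
have jA : j \notin A by apply: contra vA => jA; rewrite vE imset_f.
have := hA _ _ iA jA; rewrite vE /r /=.
have := ltn_ord (tau i); have := ltn_ord (tau j).
by clear; move: (tau i) (tau j) => a b; lia.
Qed.

End Orders.

Section CoordinateSums.
Context {R : realType} {d : nat}.
Implicit Types (P Q X : set 'rV[R]_d) (A B K : {set 'I_d}) (x v : 'rV[R]_d).

Definition row_sum A x : R := \sum_(i in A) x 0 i.

Lemma row_sumD A x v : row_sum A (x + v) = row_sum A x + row_sum A v.
Proof. by rewrite -big_split; apply: eq_bigr => i _; rewrite mxE. Qed.

Lemma row_sumZ A t x : row_sum A (t *: x) = t * row_sum A x.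
Proof. by rewrite /row_sum mulr_sumr; apply: eq_bigr => i _; rewrite mxE. Qed.

Lemma row_sum0 A : row_sum A 0 = 0.
Proof. by rewrite /row_sum big1 // => i _; rewrite mxE. Qed.

Lemma row_sumN A x : row_sum A (- x) = - row_sum A x.
Proof. by rewrite -scaleN1r row_sumZ mulN1r. Qed.

Lemma row_sum_comb A n (a : 'I_n -> R) (v : 'I_n -> 'rV[R]_d) :
  row_sum A (\sum_i a i *: v i) = \sum_i a i * row_sum A (v i).
Proof.
rewrite (@big_morph _ _ (row_sum A) 0 +%R _ _ (row_sumD A) (row_sum0 A)).
by apply: eq_bigr => i _; rewrite row_sumZ.
Qed.

Lemma row_sum_delta A i : row_sum A (delta_mx 0 i) = (i \in A)%:R.
Proof.
rewrite /row_sum; case: (boolP (i \in A)) => iA.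
  rewrite (bigD1 i) //= big1 ?mxE ?eqxx ?addr0 // => j /andP[_ /negbTE ji].
  by rewrite mxE ji.
by rewrite big1 // => j jA; rewrite mxE eqxx; case: eqP => // ji; rewrite -ji jA in iA.
Qed.

Lemma row_sumUI x A B :
  row_sum (A :|: B)%SET x + row_sum (A :&: B)%SET x = row_sum A x + row_sum B x.
Proof. exact: sum_setUI. Qed.

Lemma sub_conv X : X `<=` conv X.
Proof.
move=> x Xx; exists 1%N, (fun=> 1), (fun=> x).
by split=> //; rewrite big_ord1 // scale1r.
Qed.

Lemma row_sum_conv_le A X m : (forall x, X x -> row_sum A x <= m) ->
  forall x, conv X x -> row_sum A x <= m.
Proof.
move=> hX _ [n [a [v [a0 a1 vX ->]]]]; rewrite row_sum_comb.
rewrite -[m]mul1r -a1 mulr_suml; apply: ler_sum => i _.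
by rewrite ler_wpM2l // hX.
Qed.

Lemma conv_convex X (s : R) x v : 0 <= s <= 1 -> conv X x -> conv X v ->
  conv X (s *: x + (1 - s) *: v).
Proof.
move=> /andP[s0 s1] [n [a [u [a0 a1 uX ->]]]] [m [b [w [b0 b1 wX ->]]]].
pose g (k : 'I_(n + m)) := match fintype.split k with inl i => s * a i | inr j => (1 - s) * b j end.
pose q (k : 'I_(n + m)) := match fintype.split k with inl i => u i | inr j => w j end.
exists (n + m)%N, g, q; split.
- by move=> k; rewrite /g; case: fintype.split => i; rewrite mulr_ge0 ?subr_ge0.
- rewrite big_split_ord /=.
  under eq_bigr => i _ do rewrite /g (unsplitK (inl i)).
  under [X in _ + X]eq_bigr => i _ do rewrite /g (unsplitK (inr i)).
  by rewrite -!mulr_sumr a1 b1; lra.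
- by move=> k; rewrite /q; case: fintype.split.
- rewrite big_split_ord /= !scaler_sumr; congr (_ + _); apply: eq_bigr => i _.
    by rewrite /g /q (unsplitK (inl i)) scalerA.
  by rewrite /g /q (unsplitK (inr i)) scalerA.
Qed.

Definition is_max A X (m : R) : Prop :=
  (exists2 x, X x & row_sum A x = m) /\ forall x, X x -> row_sum A x <= m.

Lemma is_max_uniq A X m m' : is_max A X m -> is_max A X m' -> m = m'.
Proof.
move=> [[x Xx <-] hx] [[v Xv <-] hv]; apply/eqP; rewrite eq_le hx // hv //.
Qed.

Lemma is_max_conv A X m : is_max A X m -> is_max A (conv X) m.
Proof.
move=> [[x Xx xm] hx]; split; last exact: row_sum_conv_le.
by exists x => //; exact: sub_conv.
Qed.

Lemma is_max_msum A X Q m m' : is_max A X m -> is_max A Q m' -> is_max A (msum X Q) (m + m').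
Proof.
move=> [[x Xx <-] hx] [[v Xv <-] hv]; split.
  by exists (x + v); [exists x => //; exists v | rewrite row_sumD].
by move=> _ [x' Xx' [v' Xv' <-]]; rewrite row_sumD lerD ?hx ?hv.
Qed.

Lemma is_max_dilate A X m t : 0 <= t -> is_max A X m -> is_max A (dilate t X) (t * m).
Proof.
move=> t0 [[x Xx <-] hx]; split; first by exists (t *: x); [exists x|rewrite row_sumZ].
by move=> _ [x' Xx' <-]; rewrite row_sumZ ler_wpM2l // hx.
Qed.

Lemma is_max_simplex A K : K != finset.set0 -> is_max A (simplex K) (meets K A)%:R.
Proof.
move=> K0; rewrite /simplex (negbTE K0); apply: is_max_conv; split; last first.
  move=> _ [i iK ->]; rewrite row_sum_delta ler_nat /meets.
  case: (boolP (i \in A)) => // iA; rewrite lt0b; apply/set0Pn; exists i.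
  by rewrite finset.inE iK.
rewrite /meets; have [KA|/set0Pn[i]] := eqVneq (K :&: A)%SET finset.set0.
  have /set0Pn[i iK] := K0; exists (delta_mx 0 i); first by exists i.
  rewrite row_sum_delta; case: (boolP (i \in A)) => // iA.
  by have := finset.in_set0 i; rewrite -KA finset.inE iK iA.
rewrite finset.inE => /andP[iK iA]; exists (delta_mx 0 i); first by exists i.
by rewrite row_sum_delta iA.
Qed.

Lemma is_max_weighted_msum A (J : pred {set 'I_d}) (y : {set 'I_d} -> R) :
  (forall K, J K -> 0 <= y K) ->
  is_max A (weighted_msum J y) (\sum_(K | (K != finset.set0) && J K) y K * (meets K A)%:R).
Proof.
move=> y0; rewrite /weighted_msum.
elim/big_rec2: _ => [|K m X /andP[K0 JK] hX].
  by split; [exists 0; rewrite ?row_sum0 | move=> x ->; rewrite row_sum0].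
apply: is_max_msum hX; apply: is_max_dilate; [exact: y0|exact: is_max_simplex].
Qed.

(** Maxima of x(A) are additive under Minkowski sums; comparing both sides of the representation,
    the negative terms move back. *)
Lemma signed_rep_max P y (z : {set 'I_d} -> R) : signed_minkowski_rep P y ->
  (forall A, is_max A P (z A)) ->
  forall A, z A = \sum_(K | K != finset.set0) y K * (meets K A)%:R.
Proof.
move=> rep hz A.
have h1 := is_max_msum (hz A)
  (@is_max_weighted_msum A (fun K => y K < 0) (fun K => - y K)
    (fun K yK => etrans (oppr_ge0 (y K)) (ltW yK))).
rewrite rep in h1.
have E := is_max_uniq h1 (@is_max_weighted_msum A (fun K => 0 <= y K) y (fun K yK => yK)).
rewrite (bigID (fun K => 0 <= y K)) /= -E.
rewrite -addrA -[LHS]addr0; congr (_ + _).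
under [X in _ + X]eq_bigl => K do rewrite -ltNge.
by rewrite -big_split big1 //= => K _; rewrite mulNr addNr.
Qed.

(** Each coordinate is the difference of the sums over two consecutive initial segments. *)
Lemma row_sum_initial_eq tau x v :
  (forall A, initial tau A -> row_sum A x = row_sum A v) -> x = v.
Proof.
move=> h; apply/rowP => i.
pose B := [set j | (tau j < tau i)%N]%SET.
have iB : i \notin B by rewrite finset.inE ltnn.
have hB : initial tau B.
  by move=> j k; rewrite !finset.inE -leqNgt; exact: leq_trans.
have hiB : initial tau (i |: B)%SET.
  move=> j k; rewrite !finset.inE negb_or -leqNgt => jB /andP[ki ik].
  have {ik} : (tau i < tau k)%N.
    by rewrite ltn_neqAle ik andbT; apply: contraNneq ki => /val_inj/perm_inj ->.
  by case/orP: jB => [/eqP -> //|/ltn_trans]; apply.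
by have := h _ hiB; rewrite /row_sum !big_setU1 //= -!/(row_sum _ _) h // => /addIr.
Qed.

End CoordinateSums.

(** * Support functions of generalized permutahedra *)

Section SupportFunction.
Context {R : realType} {d : nat}.
Implicit Types (P Q : set 'rV[R]_d) (A B K : {set 'I_d}) (x v : 'rV[R]_d).
Implicit Types (tau : 'S_d).

(* The last clause makes the support function of [P], whose values at 0/1-vectors
   are given by [z], linear on the cones of the braid fan. *)
Definition support_function P (z : {set 'I_d} -> R) : Prop :=
  [/\ forall x A, P x -> row_sum A x <= z A,
      forall x, P x -> row_sum [set: 'I_d]%SET x = z [set: 'I_d]%SET
    & forall tau, exists2 v, P v & forall A, initial tau A -> row_sum A v = z A].

(** The vertex of Pi_d giving the values d, d-1, ..., 1 in the order [tau]. *)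
Definition top_point tau : 'rV[R]_d := \row_i (rev_ord (tau i)).+1%:R.

Lemma top_point_in tau : permutahedron (top_point tau).
Proof.
have rinj : injective (fun i => rev_ord (tau i)) by move=> i j /rev_ord_inj/perm_inj.
by apply: sub_conv; exists (perm rinj); apply/rowP => i; rewrite !mxE permE.
Qed.

Lemma top_point_max tau A x : initial tau A -> permutahedron x ->
  row_sum A x <= row_sum A (top_point tau).
Proof.
move=> hA; apply: row_sum_conv_le => _ [s ->].
rewrite /row_sum; under eq_bigr => i _ do rewrite mxE -natr1.
under [leRHS]eq_bigr => i _ do rewrite mxE -natr1.
rewrite !big_split /= lerD2r -!natr_sum ler_nat.
exact: sum_perm_le.
Qed.

Lemma permutahedron_row_sumT (x v : 'rV[R]_d) : permutahedron x -> permutahedron v ->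
  row_sum [set: 'I_d]%SET x = row_sum [set: 'I_d]%SET v.
Proof.
suff h : forall u : 'rV[R]_d, permutahedron u ->
    row_sum [set: 'I_d]%SET u = \sum_(i < d) i.+1%:R by move=> /h -> /h ->.
move=> u [n [a [w [a0 a1 wX ->]]]].
rewrite row_sum_comb -[RHS]mul1r -[X in _ = X * _]a1 mulr_suml; apply: eq_bigr => i _.
have [t ->] := wX i; congr (_ * _); rewrite [RHS](reindex_inj (@perm_inj _ t)) /=.
by apply: eq_big => [j|j _]; rewrite ?finset.inE ?mxE.
Qed.

Lemma gp_support_function P : generalized_permutahedron P ->
  exists z, support_function P z.
Proof.
move=> [t t0 [_ [Q _ PQ]]].
have top tau : exists2 v, P v & forall A x, initial tau A -> P x -> row_sum A x <= row_sum A v.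
  have : dilate t permutahedron (t *: top_point tau) by exists (top_point tau) => //; exact: top_point_in.
  rewrite -PQ => -[v Pv [q Qq vq]]; exists v => // A x hA Px.
  (* [v + q] maximises x(A) over t Pi_d and [x + q] competes with it; the common [q] cancels. *)
  have : dilate t permutahedron (x + q) by rewrite -PQ; exists x => //; exists q.
  move=> [u Pu uE]; rewrite -(lerD2r (row_sum A q)) -!row_sumD -uE vq !row_sumZ.
  by rewrite ler_wpM2l ?(ltW t0) // top_point_max.
have sumT x v : P x -> P v -> row_sum [set: 'I_d]%SET x = row_sum [set: 'I_d]%SET v.
  have : dilate t permutahedron (t *: top_point 1%g) by exists (top_point 1%g) => //; exact: top_point_in.
  rewrite -PQ => -[_ _ [q Qq _]] Px Pv.
  have : dilate t permutahedron (x + q) by rewrite -PQ; exists x => //; exists q.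
  have : dilate t permutahedron (v + q) by rewrite -PQ; exists v => //; exists q.
  move=> [u Pu uE] [u' Pu' uE']; apply: (addIr (row_sum [set: 'I_d]%SET q)).
  by rewrite -!row_sumD -uE -uE' !row_sumZ (permutahedron_row_sumT Pu Pu').
have /choice[z hz] : forall A, exists m, is_max A P m.
  move=> A; have [tau [hA _]] := exists_initial2 (fintype.subxx A).
  have [v Pv vmax] := top tau; exists (row_sum A v).
  by split; [exists v|move=> x; exact: vmax].
exists z; split=> [x A|x Px|tau]; first exact: (hz A).2.
  by have [[v Pv <-] _] := hz [set: 'I_d]%SET; exact: sumT.
have [v Pv vmax] := top tau; exists v => // A hA; apply/eqP.
rewrite eq_le (hz A).2 //=; have [[x Px <-] _] := hz A; exact: vmax.
Qed.

Section Properties.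
Variables (P : set 'rV[R]_d) (z : {set 'I_d} -> R).
Hypothesis hz : support_function P z.

Lemma support_function_max A : is_max A P (z A).
Proof.
have [h _ htau] := hz; have [tau [hA _]] := exists_initial2 (fintype.subxx A).
have [v Pv vz] := htau tau.
by split; [exists v => //; exact: vz | move=> x; exact: h].
Qed.

Lemma support_function0 : z finset.set0 = 0.
Proof. by have [[x _ <-] _] := support_function_max finset.set0; rewrite /row_sum big_set0. Qed.

(** Intersection and union are nested, so one point of [P] attains both values. *)
Lemma support_function_submodular : submodular z.
Proof.
move=> A B; have [h _ htau] := hz.
have AB : (A :&: B \subset A :|: B)%SET.
  exact: fintype.subset_trans (finset.subsetIl _ _) (finset.subsetUl _ _).
have [tau [hI hU]] := exists_initial2 AB; have [v Pv vz] := htau tau.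
by rewrite -(vz _ hU) -(vz _ hI) row_sumUI lerD ?h.
Qed.

Lemma support_function_vertex A : exists2 v, vertex P v & row_sum A v = z A.
Proof.
have [h _ htau] := hz; have [tau [hA _]] := exists_initial2 (fintype.subxx A).
have [v Pv vz] := htau tau; exists v; last exact: vz.
(* [c] adds the indicators of all initial segments. A point with the same [c]-value as [v] agrees
   with it on every initial segment, hence equals it. *)
split=> //; pose c : 'rV[R]_d := \row_i \sum_(B | `[< initial tau B >]) (i \in B)%:R.
exists c => x Px xv.
have cE (u : 'rV[R]_d) : \sum_i c 0 i * u 0 i = \sum_(B | `[< initial tau B >]) row_sum B u.
  under eq_bigr => i _ do rewrite mxE mulr_suml.
  rewrite exchange_big; apply: eq_bigr => B _; rewrite /row_sum [RHS]big_mkcond.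
  by apply: eq_bigr => i _; case: (i \in B); rewrite ?mul1r ?mul0r.
rewrite !cE lt_neqAle ler_sum ?andbT => [|B /asboolP hB]; last by rewrite vz // h.
apply/eqP => E; apply: xv; apply: (row_sum_initial_eq (tau := tau)) => B hB.
apply/eqP; rewrite -subr_eq0 -oppr_eq0 opprB.
move: E => /esym/eqP; rewrite -subr_eq0 -sumrB psumr_eq0 => [/allP/(_ B)|].
  by rewrite mem_index_enum => /(_ isT)/implyP; apply; exact/asboolP.
by move=> C /asboolP hC; rewrite subr_ge0 vz // h.
Qed.

(** Induction on the number of loose sets. If no tight set separates some i and j, then x lies
    between two points with fewer loose sets, reached along e_i - e_j and its opposite. Otherwise
    the tight sets determine an order whose initial segments are all tight, and x is the point of
    [P] belonging to it. *)
Lemma base_point_in x :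
  (forall (s : R) u v, 0 <= s <= 1 -> P u -> P v -> P (s *: u + (1 - s) *: v)) ->
  row_sum [set: 'I_d]%SET x = z [set: 'I_d]%SET ->
  (forall A, row_sum A x <= z A) -> P x.
Proof.
move=> Pconv; have [h hT htau] := hz.
pose loose x := [set A | row_sum A x != z A]%SET.
have [n] := ubnP #|loose x|; elim: n x => // n IH x; rewrite ltnS => xn xT xz.
have sub := support_function_submodular.
have tightUI A B : row_sum A x = z A -> row_sum B x = z B ->
    row_sum (A :|: B)%SET x = z (A :|: B)%SET /\ row_sum (A :&: B)%SET x = z (A :&: B)%SET.
  move=> hA hB; have := sub A B; have := row_sumUI x A B; rewrite hA hB.
  by have := xz (A :|: B)%SET; have := xz (A :&: B)%SET; split; lra.
have shift i j : i != j -> (forall A, row_sum A x = z A -> (i \in A) = (j \in A)) ->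
    exists2 e : R, 0 < e & P (x + e *: (delta_mx 0 i - delta_mx 0 j)).
  move=> ij insep; pose W A := (i \in A) && (j \notin A).
  have Wi : W [set i]%SET by rewrite /W !finset.inE eqxx eq_sym.
  (* Only the sums over sets with i but not j grow; the least slack among them is the admissible
     step, and it makes [B] tight. *)
  have [B WB Bmin] := @arg_minP _ _ _ [set i]%SET W (fun A => z A - row_sum A x) Wi.
  have tightW A : row_sum A x = z A -> ~~ W A.
    by move=> /insep hA; rewrite /W hA andbN.
  have e0 : 0 < z B - row_sum B x.
    rewrite subr_gt0 lt_neqAle xz andbT; apply: contraL WB => /eqP; exact: tightW.
  have [e eE] : exists e, e = z B - row_sum B x by eexists.
  rewrite -eE in e0 Bmin; exists e => //; set x' := _ + _.
  have x'E A : row_sum A x' = row_sum A x + e * ((i \in A)%:R - (j \in A)%:R).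
    by rewrite row_sumD row_sumZ row_sumD row_sumN !row_sum_delta.
  apply: IH.
  - apply: leq_trans xn; rewrite proper_card // properE; apply/andP; split.
      apply/fintype.subsetP => A; rewrite !finset.inE; apply: contraNN => /eqP hA.
      by rewrite x'E insep // subrr mulr0 addr0 hA.
    apply/subsetPn; exists B; rewrite !finset.inE.
      by apply: contraL WB => /eqP; exact: tightW.
    rewrite negbK x'E; case/andP: WB => -> /negbTE ->.
    by rewrite subr0 mulr1 eE addrC subrK.
  - by rewrite x'E !finset.inE subrr mulr0 addr0.
  - move=> A; rewrite x'E; move: (xz A) (Bmin A); rewrite /W.
    case: (i \in A); case: (j \in A) => /= xA hA; rewrite ?subrr ?subr0 ?sub0r ?mulr1 ?mulr0;
      by [lra | have := hA isT; lra].
have [/existsP[i /existsP[j /andP[ij /forallP insep]]]|sep] := boolP [exists i, exists j, (i != j) &&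
    [forall A : {set 'I_d}, (row_sum A x == z A) ==> ((i \in A) == (j \in A))]].
  have [|e e0 Pe] := shift i j ij.
    by move=> A /eqP hA; apply/eqP; exact: (implyP (insep A)).
  have [||g g0 Pg] := shift j i.
  - by rewrite eq_sym.
  - by move=> A /eqP hA; apply/esym/eqP; exact: (implyP (insep A)).
  have eg : e + g != 0 by apply: lt0r_neq0; lra.
  have -> : x = (g / (e + g)) *: (x + e *: (delta_mx 0 i - delta_mx 0 j)) +
      (1 - g / (e + g)) *: (x + g *: (delta_mx 0 j - delta_mx 0 i)).
    by apply/rowP => k; rewrite !mxE; field; lra.
  apply: Pconv => //; rewrite divr_ge0 ?ler_pdivrMr; lra.
(* [D i] is the smallest tight set containing i. Distinct elements have distinct [D i], so in an
   order by |D i| an initial segment is the union of the [D i] of its elements, and unions of tight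
   sets are tight. *)
pose D i := (\bigcap_(A | (row_sum A x == z A) && (i \in A)) A)%SET.
have tightD i : row_sum (D i) x = z (D i).
  apply: (big_ind (fun A => row_sum A x = z A)) => // [A B hA hB|A /andP[/eqP //]].
  by case: (tightUI A B hA hB).
have iD i : i \in D i by apply/finset.bigcapP => A /andP[].
have Dsub i A : row_sum A x = z A -> i \in A -> D i \subset A.
  by move=> hA iA; apply: finset.bigcap_inf; rewrite hA eqxx.
have Dinj i j : D i = D j -> i = j.
  move=> Dij; apply/eqP; apply: contraNT sep => ij.
  apply/existsP; exists i; apply/existsP; exists j; rewrite ij /=.
  apply/forallP => A; apply/implyP => /eqP hA; apply/eqP; apply/idP/idP => h'.
    by apply: (fintype.subsetP (Dsub _ _ hA h')); rewrite Dij.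
  by apply: (fintype.subsetP (Dsub _ _ hA h')); rewrite -Dij.
have [tau htau'] := exists_order (fun i => #|D i|).
have [v Pv vz] := htau tau; suff -> : x = v by [].
apply: (row_sum_initial_eq (tau := tau)) => A hA; rewrite vz //.
have -> : A = (\bigcup_(i in A) D i)%SET.
  apply/setP => k; apply/idP/finset.bigcupP => [kA|[i iA kD]]; first by exists k.
  apply/negPn/negP => kA; have := hA _ _ iA kA.
  have DkDi : D k \subset D i by exact: Dsub.
  have [Dlt|Dge] := ltnP #|D k| #|D i|.
    by have := htau' _ _ Dlt; case: ltngtP.
  have /eqP/Dinj ki : D k == D i by rewrite eqEcard DkDi.
  by rewrite ki iA in kA.
apply: (big_ind (fun A => row_sum A x = z A)) => // [|B C hB hC].
  by rewrite support_function0 /row_sum big_set0.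
by case: (tightUI B C hB hC).
Qed.

End Properties.
End SupportFunction.

(** * Ehrhart polynomials *)

Section Moebius.
Context {T : finType}.
Implicit Types (I K : {set T}).

(** Moebius inversion, with [y] built by recursion on the size of the set. *)
Lemma subset_sum_inversion (V : zmodType) (g : {set T} -> V) :
  exists y : {set T} -> V, forall I, g I = \sum_(K : {set T} | K \subset I) y K.
Proof.
suff h n : exists y : {set T} -> V,
    forall I, (#|I| < n)%N -> g I = \sum_(K : {set T} | K \subset I) y K.
  have [y hy] := h #|T|.+1; exists y => I; apply: hy; rewrite ltnS; exact: max_card.
elim: n => [|n [y hy]]; first by exists (fun=> 0).
have subsetD1 (w : {set T} -> V) I :
    \sum_(K : {set T} | K \subset I) w K = w I + \sum_(K : {set T} | K \proper I) w K.
  rewrite (bigD1 I) //=; congr (_ + _); apply: eq_bigl => K.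
  by rewrite finset.properEneq andbC.
pose y' I := if #|I| == n then g I - \sum_(K : {set T} | K \proper I) y K else y I.
exists y' => I In; rewrite subsetD1.
have -> : \sum_(K : {set T} | K \proper I) y' K = \sum_(K : {set T} | K \proper I) y K.
  apply: eq_bigr => K /proper_card KI; rewrite /y' ltn_eqF //.
  exact: leq_trans KI In.
rewrite /y'; case: eqP => [_|/eqP nI]; first by rewrite subrK.
by rewrite hy ?subsetD1 // ltn_neqAle nI -ltnS.
Qed.

(** [K] misses [I] exactly when it lies in ~I, so z(T) - z(~I) has to be the sum of [y] over the
    subsets of [I]. *)
Lemma meets_inversion (V : comRingType) (z : {set T} -> V) : z finset.set0 = 0 ->
  exists y : {set T} -> V,
    forall I, z I = \sum_(K : {set T} | K != finset.set0) y K * (meets K I)%:R.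
Proof.
move=> z0; have [y hy] := subset_sum_inversion (fun I => z [set: T]%SET - z (~: I)%SET).
exists y => I.
have -> : z I = \sum_(K : {set T} | K \subset [set: T]%SET) y K -
    \sum_(K : {set T} | K \subset (~: I)%SET) y K.
  by rewrite -!hy finset.setCT z0 finset.setCK; ring.
rewrite (bigID (fun K : {set T} => K \subset (~: I)%SET)) /=.
rewrite (eq_bigl (fun K : {set T} => K \subset (~: I)%SET)) => [|K]; last by rewrite finset.subsetT.
rewrite addrAC subrr add0r big_mkcond [RHS]big_mkcond /=; apply: eq_bigr => K _.
rewrite finset.subsetT /= /meets finset.setI_eq0 finset.disjoints_subset.
have [->|K0] := eqVneq K finset.set0; first by rewrite finset.sub0set.
by case: (K \subset _); rewrite ?mulr0 ?mulr1.
Qed.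

End Moebius.

Section Ehrhart.
Context {R : realType} {d : nat}.
Implicit Types (P : set 'rV[R]_d) (A K : {set 'I_d}).

Definition int_row (x : {ffun 'I_d -> int}) : 'rV[R]_d := \row_i (x i)%:~R.

Lemma int_row_inj : injective int_row.
Proof.
by move=> x x' /rowP h; apply/ffunP => i; apply/eqP; have /eqP := h i; rewrite !mxE eqr_int.
Qed.

Lemma row_sum_int_row A x : row_sum A (int_row x) = (set_sum x A)%:~R.
Proof. by rewrite rmorph_sum; apply: eq_bigr => i _; rewrite mxE. Qed.

Lemma gp_convex P : generalized_permutahedron P ->
  forall (s : R) u v, 0 <= s <= 1 -> P u -> P v -> P (s *: u + (1 - s) *: v).
Proof. by move=> [t _ [[s ->] _]] r u v; exact: conv_convex. Qed.

Lemma gp_lattice_points P (z : {set 'I_d} -> R) (zi : {ffun {set 'I_d} -> int}) n :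
  generalized_permutahedron P -> support_function P z -> (forall A, z A = (zi A)%:~R) ->
  (0 < n)%N ->
  dilate n%:R P `&` [set x | integral_point x] = int_row @` base_points (zi *+ n).
Proof.
move=> gP hz zzi n0; have [h hT _] := hz.
have nR : 0 < n%:R :> R by rewrite ltr0n.
have ziE A : ((zi *+ n) A)%:~R = n%:R * z A.
  by rewrite ffunMnE rmorphMn /= -zzi mulr_natl.
apply/seteqP; split=> [_ [[u Pu <-] uint]|_ [x [xT xz] <-]].
  have /choice[f hf] : forall i, exists m : int, (n%:R *: u) 0 i = m%:~R.
    by move=> i; exact/intrP/(uint i).
  have fE : int_row [ffun i => f i] = n%:R *: u by apply/rowP => i; rewrite mxE ffunE -hf.
  exists [ffun i => f i] => //; split.
    by apply/eqP; rewrite -(eqr_int R) -row_sum_int_row fE row_sumZ ziE hT.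
  by move=> A; rewrite -(ler_int R) -row_sum_int_row fE row_sumZ ziE ler_pM2l // h.
split; last by move=> i; rewrite mxE; exact: intr_int.
exists (n%:R^-1 *: int_row x); last by rewrite scalerA mulfV ?scale1r // lt0r_neq0.
apply: (base_point_in hz); first exact: gp_convex.
  by rewrite row_sumZ row_sum_int_row xT ziE mulKf // lt0r_neq0.
move=> A; rewrite row_sumZ row_sum_int_row ler_pdivrMl // -ziE ler_int; exact: xz.
Qed.

Local Open Scope card_scope.

Lemma fsum1_card (U : choiceType) (X : set U) k : X #= `I_k -> \sum_(x \in X) (1 : int) = k%:Z.
Proof.
move=> Xk; rewrite fsbig_finite; last by apply/finite_setP; exists k.
by rewrite big_const_seq count_predT iter_addr_0 (card_fset_set Xk) natz.
Qed.

End Ehrhart.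

Theorem theorem4p5 (R : realType) (d : nat) (hd : (2 <= d)%N)
    (P : set 'rV[R]_d) (hP : generalized_permutahedron P) :
  (forall y : {set 'I_d} -> R,
     signed_minkowski_rep P y -> 0 <= mink_functional y) /\
  (integer_vertices P ->
     forall p : {poly R}, ehrhart_polynomial P p -> 0 <= p`_1).
Proof.
have [z hz] := gp_support_function hP.
have core (y : {set 'I_d} -> R) :
    (forall A, z A = \sum_(K | K != finset.set0) y K * (meets K A)%:R) -> 0 <= mink_functional y.
  move=> zy; apply: mink_functional_ge0 => A B; rewrite -!zy.
  exact: (support_function_submodular hz).
split=> [y rep|Pint p hp].
  by apply: core; apply: (signed_rep_max rep) => A; exact: (support_function_max hz).
(* Every value of [z] is attained at a vertex, hence is an integer. *)
have /choice[f hf] : forall A, exists m : int, z A = m%:~R.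
  move=> A; apply/intrP; have [v vP <-] := support_function_vertex hz A.
  by apply: rpred_sum => i _; exact: Pint.
pose zi : {ffun {set 'I_d} -> int} := [ffun A => f A].
have zzi A : z A = (zi A)%:~R by rewrite ffunE -hf.
have zi0 : zi finset.set0 = 0.
  by apply/eqP; rewrite -(eqr_int R) -zzi (support_function0 hz).
(* Inversion over the integers gives integral coefficients, as the linear coefficient formula
   requires; cast to [R], they satisfy the hypothesis of [core]. *)
have [y hy] := meets_inversion zi0.
have -> : p`_1 = mink_functional (fun K => (y K)%:~R).
  apply: (@base_ehrhart_lin _ _ zi) => //.
  - by rewrite -cards_eq0 cardsT card_ord -lt0n ltnW.
  - move=> A B; rewrite -(ler_int R) !rmorphD /= -!zzi; exact: (support_function_submodular hz).
  - move=> n n0; have [k Pk ->] := hp n n0.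
    rewrite (gp_lattice_points hP hz zzi n0) in Pk.
    rewrite (@fsum1_card _ _ k) //; apply: card_eq_trans Pk.
    rewrite card_eq_sym; apply: inj_card_eq => x x' _ _; exact: int_row_inj.
apply: core => A; rewrite zzi hy rmorph_sum; apply: eq_bigr => K _.
by rewrite rmorphM /= rmorph_nat.
Qed.
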